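(* Let $t=\overleftarrow\mu t[-1]$ be an injective-reachable seed satisfying the full rank assumption, where $\overleftarrow\mu$ is a mutation sequence from $t[-1]$ to $t$, and let $\mathcal U(t)$ be the upper cluster algebra. Let $\mathcal S=\{s_g\mid g\in M^\circ(t)\}\subset\mathcal U(t)$ be a collection such that each $s_g$ is pointed at $g$ in $LP(t)$. If the elements of $\mathcal S$ are compatibly pointed at the seeds appearing along the mutation sequence $\overleftarrow\mu$ from $t[-1]$ to $t$, then $\mathcal S$ is a $\Bbbk$-basis of $\mathcal U(t)$.
   Context: Conventions: $[a]_+=\max(a,0)$, $\mathbb N=\mathbb Z_{\ge 0}$; $\Bbbk=\mathbb Z$ (classical case) or $\Bbbk=\mathbb Z[q^{\pm1/2}]$ (quantum case). Fix a finite set $I=I_{uf}\sqcup I_{f}$ (unfrozen, frozen) and integers $d_i>0$. A seed $t=((b_{ij}(t))_{i,j\in I},(x_i(t))_{i\in I})$ has $b_{ij}d_j=-b_{ji}d_i$, $b_{ij}\in\mathbb Q$ if $i,j\in I_f$ and $b_{ij}\in\mathbb Z$ otherwise, and indeterminates $x_i(t)$. $\tilde B(t)=(b_{ik}(t))_{i\in I,k\in I_{uf}}$. Full rank assumption: $\tilde B(t)$ has rank $|I_{uf}|$ (preserved by mutation). $M^\circ(t)=\mathbb Z^I$ with basis $f_i$; $LP(t)=\Bbbk[M^\circ(t)]$ with basis of Laurent monomials $x(t)^m$, $x_i=x^{f_i}$. Mutation: for $k\in I_{uf}$, $t'=\mu_kt$ has $b'_{ij}=-b_{ij}$ if $k\in\{i,j\}$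 and $b'_{ij}=b_{ij}+b_{ik}[b_{kj}]_++[-b_{ik}]_+b_{kj}$ otherwise; $\mu_k^*$ identifies the (skew-)fields of fractions $\mathcal F(t')\simeq\mathcal F(t)$ by $x_i'\mapsto x_i$ ($i\neq k$), $x_k'\mapsto x^{-f_k+\sum_j[-b_{jk}]_+f_j}+x^{-f_k+\sum_j[b_{jk}]_+f_j}$. In the quantum case, $M^\circ(t)$ carries a skew-symmetric $\mathbb Z$-valued form $\lambda$ with $\lambda(f_i,\tilde B(t)e_k)=-\delta_{ik}d_k'$ ($d_k'>0$ integers), $LP(t)$ has the product $x^m*x^{m'}=q^{\lambda(m,m')/2}x^{m+m'}$, and $\lambda$ is transported to $\mu_kt$ via $f_i'\mapsto f_i$, $f_k'\mapsto-f_k+\sum_j[-b_{jk}]_+f_j$. $\mathcal U(t)=\bigcap_{s}LP(s)$, over all seeds $s$ obtained from $t$ by iterated mutations, under the identifications of fraction fields. Tropical transformation $\phi_{\mu_kt,t}:M^\circ(t)\to M^\circ(\mu_kt)$: $g'_k=-g_k$, $g_i'=g_i+[b_{ik}]_+[g_k]_+-[-b_{ik}]_+[-g_k]_+$ ($i\neq k$); $\phi_{t',t}$ is the composition along any mutation sequence. Dominance order: $g'\preceq_tg$ iff $g'=g+\tilde B(t)n$, $n\in\mathbb N^{I_{uf}}$. $z\in LP(t)$ has degree $\deg^tz=g$ if $g$ is the unique $\prec_t$-maximal Laurent degree of $z$; it is pointed at $g$ if moreover the coefficient of $x^g$ is $1$. For a set $S$ of seeds related by mutations, $z\in\bigcap_{s\in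 S}LP(s)$ is compatibly pointed at $S$ if it is pointed in $LP(s)$ at some $g(s)\in M^\circ(s)$ for all $s\in S$, with $g(s')=\phi_{s',s}g(s)$ for all $s,s'\in S$. Injective-reachability: $t$ is injective-reachable if there are a seed $t[1]$ obtained from $t$ by mutations and a permutation $\sigma$ of $I_{uf}$ with $\deg^t(x_k(t[1]))\in-f_{\sigma(k)}+\mathbb Z^{I_f}$ for all $k\in I_{uf}$ (cluster variables have degrees in every $LP(t)$). If one seed is injective-reachable so are all seeds related to it by mutations; $t[-1]$ denotes a seed with $(t[-1])[1]=t$. *)

(* Defs.v *)
From HB Require Import structures.
From mathcomp Require Import all_boot all_order all_fingroup all_algebra.
From mathcomp Require Import fraction archimedean finmap.
From mathcomp Require Import boolp classical_sets.
Set Implicit Arguments.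
Unset Strict Implicit.
Unset Printing Implicit Defensive.
Import Order.TTheory GRing.Theory Num.Theory.
Local Open Scope fset_scope.
Local Open Scope classical_set_scope.
Local Open Scope ring_scope.

(* Z[q^(1/2), q^(-1/2)] is realized inside the field of fractions of Z['X],
   with 'X in the role of q^(1/2): it consists of the fractions having some
   power of 'X as a denominator. *)
Definition is_qlaurent : {pred {fraction {poly int}}} := fun z =>
  `[< exists n p, z * tofrac ('X^n) = tofrac p >].

Lemma qlaurent_subring : subring_closed is_qlaurent.
Proof.
split=> [|y z /asboolP[m [p yp]] /asboolP[n [r zr]]|
         y z /asboolP[m [p yp]] /asboolP[n [r zr]]]; apply/asboolP.
- by exists 0, 1; rewrite mul1r.
- exists (m + n)%N, (p * 'X^n - r * 'X^m).
  rewrite exprD rmorphB !rmorphM /= -yp -zr mulrBl mulrA; congr (_ - _).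
  by rewrite [tofrac ('X^m) * _]mulrC mulrA.
- exists (m + n)%N, (p * r).
  by rewrite exprD !rmorphM /= -yp -zr mulrACA.
Qed.

HB.instance Definition _ := GRing.isSubringClosed.Build
  {fraction {poly int}} is_qlaurent qlaurent_subring.

Record qlaurent := QLaurent {
  qlaurent_val :> {fraction {poly int}};
  qlaurent_valP : qlaurent_val \in is_qlaurent }.
HB.instance Definition _ := [isSub for qlaurent_val].
HB.instance Definition _ := [Choice of qlaurent by <:].
HB.instance Definition _ := [SubChoice_isSubComNzRing of qlaurent by <:].

Lemma is_qlaurentXz (z : int) : (tofrac 'X : {fraction {poly int}}) ^ z \in is_qlaurent.
Proof.
apply/asboolP; case: z => n.
  by exists 0, 'X^n; rewrite expr0 rmorph1 mulr1 rmorphXn.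
exists n.+1, 1; rewrite NegzE -exprnN rmorphXn /= rmorph1 mulVf //.
by rewrite expf_neq0 // tofrac_eq0 polyX_eq0.
Qed.

Variant flavour := Classical | Quantum.

Definition base (c : flavour) : comNzRingType :=
  match c with Classical => int | Quantum => qlaurent end.

(* [qhalf c z] is q^(z/2), which is specialized to 1 in the classical case. *)
Definition qhalf (c : flavour) : int -> base c :=
  match c with
  | Classical => fun=> 1
  | Quantum => fun z => QLaurent (is_qlaurentXz z)
  end.

Definition pos_part {R : numDomainType} (a : R) : R := Num.max a 0.

(* The index set is the disjoint union of [U] (unfrozen) and [Fz] (frozen). *)
Definition lattice (U Fz : finType) := {ffun U + Fz -> int}.

Definition fvec (U Fz : finType) (i : U + Fz) : lattice U Fz :=
  [ffun j => (i == j)%:R].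

(* All seeds live in one (skew-)field [F], so that the identifications of the
   fraction fields of different seeds become equalities in [F].  The form [lam]
   is recorded by its matrix in the basis [fvec]; it plays no role in the
   classical case, where it is required to be 0 (see [is_seed]). *)
Record seed (c : flavour) (U Fz : finType) (F : unitAlgType (base c)) := Seed {
  exch : {ffun (U + Fz) * (U + Fz) -> rat};
  lam : {ffun (U + Fz) * (U + Fz) -> int};
  var : {ffun U + Fz -> F} }.

Section Seeds.
Variables (c : flavour) (U Fz : finType) (F : unitAlgType (base c)).
Implicit Types (s t : seed U Fz F) (g m : lattice U Fz) (k : U) (z : F).

(* Entries in an unfrozen row or column are integers in every genuine seed, so
   that taking the floor is then a mere change of type. *)
Definition bz s (i j : U + Fz) : int := Num.floor (exch s (i, j)).

Definition lamform s m m' : int :=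
  \sum_i \sum_j m i * m' j * lam s (i, j).

(* The product law x^m * x^m' = q^(lam(m,m')/2) x^(m+m') forces
   x_1^(m_1) * ... * x_r^(m_r) = q^(\sum_(i<j) m_i m_j lam_ij / 2) x^m. *)
Definition monomial s m : F :=
  qhalf c (- \sum_i \sum_(j | (enum_rank i < enum_rank j)%N)
               m i * m j * lam s (i, j))
  *: \prod_(i <- enum {: U + Fz}) var s i ^ m i.

Definition lincomb (w : lattice U Fz -> F)
  (a : {fsfun lattice U Fz -> base c with 0}) : F :=
  \sum_(m <- finsupp a) a m *: w m.

Definition lin_indep (w : lattice U Fz -> F) : Prop :=
  forall a, lincomb w a = 0 -> forall m, a m = 0.

Definition LP s : set F := [set z | exists a, z = lincomb (monomial s) a].

Definition is_basis (w : lattice U Fz -> F) (A : set F) : Prop :=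
  [/\ forall g, A (w g), lin_indep w &
      forall z, A z -> exists a, z = lincomb w a].

Definition mut_fvec s k (i : U + Fz) : lattice U Fz :=
  if i == inl k
  then - fvec (inl k) + \sum_j fvec j *~ pos_part (- bz s j (inl k))
  else fvec i.

Definition mutate s k : seed U Fz F := Seed
  [ffun p : (U + Fz) * (U + Fz) =>
    let: (i, j) := p in
    if (i == inl k) || (j == inl k) then - exch s (i, j)
    else exch s (i, j) + exch s (i, inl k) * pos_part (exch s (inl k, j))
         + pos_part (- exch s (i, inl k)) * exch s (inl k, j)]
  [ffun p : (U + Fz) * (U + Fz) =>
    lamform s (mut_fvec s k p.1) (mut_fvec s k p.2)]
  [ffun i : U + Fz =>
    if i == inl k then
      monomial s (- fvec (inl k) + \sum_j fvec j *~ pos_part (- bz s j (inl k)))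
      + monomial s (- fvec (inl k) + \sum_j fvec j *~ pos_part (bz s j (inl k)))
    else var s i].

Definition mutates s (ks : seq U) : seed U Fz F := foldl mutate s ks.

Definition Btilde s : 'M[rat]_(#|{: U + Fz}|, #|U|) :=
  \matrix_(i, k) exch s (enum_val i, inl (enum_val k)).

Definition full_rank s : Prop := \rank (Btilde s) = #|U|.

(* [Btilde s] applied to [n], as an element of the lattice. *)
Definition Bvec s (n : {ffun U -> nat}) : lattice U Fz :=
  [ffun i => \sum_k bz s i (inl k) * (n k)%:Z].

Definition division_ring : Prop := forall z : F, z != 0 -> z \is a GRing.unit.

(* The last three fields say that the Laurent monomials satisfy the product law
   of the (quantum) torus algebra, that they form a basis of [LP s] over
   [base c], and that [F] is the (skew-)field of fractions of [LP s]. *)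
Record is_seed (d : U + Fz -> nat) s : Prop := {
  seed_skew : forall i j, exch s (i, j) * (d j)%:R = - (exch s (j, i) * (d i)%:R);
  seed_int : forall i j, (forall i' j' : Fz, (i, j) <> (inr i', inr j')) ->
    exch s (i, j) \is a Num.int;
  seed_lam : match c with
    | Classical => lam s = 0
    | Quantum =>
        (forall i j, lam s (i, j) = - lam s (j, i)) /\
        exists d' : U -> nat, (forall k, (0 < d' k)%N) /\
          forall i k, lamform s (fvec i) (Bvec s [ffun l => (l == k : nat)])
                      = - ((i == inl k)%:R * (d' k)%:Z)
    end;
  seed_mul : forall m m', monomial s m * monomial s m'
                          = qhalf c (lamform s m m') *: monomial s (m + m');
  seed_free : lin_indep (monomial s);
  seed_frac : forall z, exists a b, [/\ LP s a, LP s b, b != 0 & z = a / b] }.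

Definition upper_cluster_algebra t : set F :=
  \bigcap_(ks in [set: seq U]) LP (mutates t ks).

Definition trop s k g : lattice U Fz :=
  [ffun i => if i == inl k then - g i
    else g i + pos_part (bz s i (inl k)) * pos_part (g (inl k))
             - pos_part (- bz s i (inl k)) * pos_part (- g (inl k))].

Fixpoint trops s (ks : seq U) g : lattice U Fz :=
  if ks is k :: ks' then trops (mutate s k) ks' (trop s k g) else g.

Definition dom_le s g' g : Prop := exists n, g' = g + Bvec s n.
Definition dom_lt s g' g : Prop := dom_le s g' g /\ g' <> g.

Definition dom_maximal s (A : {fset lattice U Fz}) g : Prop :=
  g \in A /\ forall g', g' \in A -> ~ dom_lt s g g'.

Definition expands_with_degree s z g
  (a : {fsfun lattice U Fz -> base c with 0}) : Prop :=
  [/\ z = lincomb (monomial s) a, dom_maximal s (finsupp a) g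
    & forall g', dom_maximal s (finsupp a) g' -> g' = g].

Definition has_degree s z g : Prop := exists a, expands_with_degree s z g a.

Definition pointed s z g : Prop :=
  exists2 a, expands_with_degree s z g a & a g = 1.

(* The tropical transformation from [s] to [s'] is the composite [trops s ks]
   along any mutation sequence [ks] from [s] to [s']. *)
Definition compatibly_pointed (S : set (seed U Fz F)) z : Prop :=
  exists g : seed U Fz F -> lattice U Fz,
    (forall s, S s -> pointed s z (g s)) /\
    (forall s s', S s -> S s' ->
       forall ks, mutates s ks = s' -> g s' = trops s ks (g s)).

Definition seeds_along s (ks : seq U) : set (seed U Fz F) :=
  [set mutates s (take j ks) | j in [set j | (j <= size ks)%N]].

(* [is_shift t t'] means t' = t[1], i.e. t = t'[-1]. *)
Definition is_shift t t' : Prop :=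
  (exists ks, t' = mutates t ks) /\
  exists sigma : {perm U}, forall k, exists g,
    has_degree t (var t' (inl k)) g /\
    forall l : U, (g + fvec (inl (sigma k))) (inl l) = 0.

Definition injective_reachable t : Prop := exists t', is_shift t t'.

End Seeds.

(* Main.v *)
(* Let [s] be a seed of the sequence and [s'] its mutation at [k].  Modulo the
   k-th column [v] of the exchange matrix, the Laurent rings of [s] and [s'] have
   the same grading, and the lowest layer of an element compatibly pointed at
   [s] and [s'] is a Laurent monomial of one of the two seeds.  Peeling off
   layers, every [z] in both Laurent rings is approximated at both seeds by the
   same finite combinations of the pointed elements, so that the coordinates of
   [z] in the completions at [s] and [s'], hence at t[-1] and t, agree.

   It remains to see that only finitely many [g] lie below given degrees both at
   t and, after tropical transformation, at t[-1].  Leading exponents for a total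
   order refining the dominance order at t[-1] define a valuation of the skew
   field; along the sequence it follows the g- and c-matrix recursions, the order
   playing the role of sign-coherence.  As t = t[-1][1], the resulting linear map
   from the lattice of t to that of t[-1] sends the columns of the exchange
   matrix to negative multiples of columns, i.e. reverses the dominance orders,
   and the valuation of the element pointed at [g] bounds its degree at t[-1]
   from below. *)
Require Import Defs.
From HB Require Import structures.
From mathcomp Require Import all_boot all_order all_fingroup all_algebra.
From mathcomp Require Import fraction archimedean finmap.
From mathcomp Require Import ring lra zify.
From mathcomp Require Import boolp classical_sets.
Set Implicit Arguments.
Unset Strict Implicit.
Unset Printing Implicit Defensive.
Import Order.TTheory GRing.Theory Num.Theory.
Local Open Scope ring_scope.
Local Open Scope fset_scope.
Local Open Scope ring_scope.

(** * Quantum Laurent monomials *)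

(** Independence follows at once from the degrees at [t]; the difficulty is that repeatedly
    subtracting leading terms at [t] need not stop. A second bound at t[-1] helps only if such a
    subtraction creates nothing new there. Equality of coordinates ensures this: a leading exponent
    at [t] carries a nonzero coordinate, so it also occurs at t[-1], below the support found there.
    No completion is built: finite combinations that are exact at and above a given exponent replace
    it. Full rank is used through integer functionals whose values on the columns are prescribed up
    to a common positive factor. Negative on all columns, they give weights and orders; zero on one
    column and positive on the others, they give layers. The Laurent monomials are known to be
    independent only at the two end seeds. In between this follows from the valuation, which takes
    distinct values on the monomials of a seed. *)

Section Base.
Variable c : flavour.

Lemma qhalf0 : qhalf c 0 = 1.
Proof. by case: c => //=; apply: val_inj; rewrite /= expr0z. Qed.

Lemma qhalfD a b : qhalf c (a + b) = qhalf c a * qhalf c b.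
Proof.
case: c => /=; first by rewrite mulr1.
by apply: val_inj; rewrite /= expfzDr // tofrac_eq0 polyX_eq0.
Qed.

Lemma qhalf_neq0 a : qhalf c a != 0.
Proof.
apply/eqP => q0; have := oner_neq0 (base c).
by rewrite -qhalf0 -(subrr a) qhalfD q0 mul0r eqxx.
Qed.

Lemma base_mul_neq0 (x y : base c) : x != 0 -> y != 0 -> x * y != 0.
Proof.
case: c x y => x y x0 y0; first by rewrite mulf_neq0.
apply/eqP => /(congr1 val) /= /eqP; rewrite mulf_eq0 => /orP[] /eqP e.
  by case/eqP: x0; apply: val_inj.
by case/eqP: y0; apply: val_inj.
Qed.

End Base.

(** * Additive maps on the lattice, and the form lambda *)

Section Linear.
Variables U Fz : finType.
Notation M := (lattice U Fz).

Definition lin (V : zmodType) (w : U + Fz -> V) (m : M) : V := \sum_i w i *~ m i.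

Lemma lin_is_additive V w : zmod_morphism (@lin V w).
Proof.
move=> x y; rewrite /lin -sumrB; apply: eq_bigr => i _.
by rewrite !ffunE mulrzBr.
Qed.

HB.instance Definition _ V w :=
  GRing.isZmodMorphism.Build M V (@lin V w) (@lin_is_additive V w).

Lemma lin_fvec V w i : @lin V w (fvec i) = w i.
Proof.
rewrite /lin (bigD1 i) //= big1 ?addr0 ?ffunE ?eqxx //.
by move=> j ji; rewrite ffunE eq_sym (negPf ji).
Qed.

Lemma eq_lin V w w' : w =1 w' -> @lin V w =1 lin w'.
Proof. by move=> e m; apply: eq_bigr => i _; rewrite e. Qed.

Lemma lin_comp (V V' : zmodType) (f : {additive V -> V'}) w m :
  f (lin w m) = lin (f \o w) m.
Proof. by rewrite raddf_sum; apply: eq_bigr => i _; rewrite raddfMz. Qed.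

Lemma lin_id m : lin (@fvec U Fz) m = m.
Proof.
apply/ffunP => j; rewrite /lin sum_ffunE (bigD1 j) //= big1 ?addr0 => [|i ij].
  by rewrite ffunMzE ffunE eqxx intz.
by rewrite ffunMzE ffunE (negPf ij) mul0rz.
Qed.

End Linear.

Section Lam.
Variables (c : flavour) (U Fz : finType) (F : unitAlgType (base c)).
Implicit Types (s : seed U Fz F) (m : lattice U Fz).

Lemma lamform_is_additive s m : zmod_morphism (lamform s m).
Proof.
move=> x y; rewrite /lamform -sumrB; apply: eq_bigr => i _.
by rewrite -sumrB; apply: eq_bigr => j _; rewrite !ffunE mulrBr mulrBl.
Qed.

HB.instance Definition _ s m :=
  GRing.isZmodMorphism.Build _ _ (lamform s m) (lamform_is_additive s m).

Definition lam_skew s := forall i j, lam s (i, j) = - lam s (j, i).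

Lemma lamformC s m m' : lam_skew s -> lamform s m m' = - lamform s m' m.
Proof.
move=> sk; rewrite /lamform exchange_big /= -sumrN; apply: eq_bigr => i _.
rewrite -sumrN; apply: eq_bigr => j _.
by rewrite sk mulrN [m j * _]mulrC.
Qed.

Lemma lamformxx s m : lam_skew s -> lamform s m m = 0.
Proof. by move=> /(@lamformC _ m m); lia. Qed.

Lemma lamform_fvec s i j : lamform s (fvec i) (fvec j) = lam s (i, j).
Proof.
rewrite /lamform (bigD1 i) //= [X in _ + X]big1 ?addr0; last first.
  by move=> k ki; rewrite big1 // => l _; rewrite !ffunE eq_sym (negPf ki) !mul0r.
rewrite (bigD1 j) //= big1 ?addr0 ?ffunE ?eqxx ?mul1r //.
by move=> l lj; rewrite !ffunE [j == l]eq_sym (negPf lj) mulr0 mul0r.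
Qed.

Lemma lamformDl s m1 m2 m : lamform s (m1 + m2) m = lamform s m1 m + lamform s m2 m.
Proof.
rewrite /lamform -big_split; apply: eq_bigr => i _ /=.
by rewrite -big_split; apply: eq_bigr => j _; rewrite !ffunE /= !mulrDl.
Qed.

Lemma lamformNl s m1 m : lamform s (- m1) m = - lamform s m1 m.
Proof.
rewrite /lamform -sumrN; apply: eq_bigr => i _ /=.
by rewrite -sumrN; apply: eq_bigr => j _; rewrite !ffunE /= !mulNr.
Qed.

Lemma lamform0l s m : lamform s 0 m = 0.
Proof. by rewrite -[0](subrr m) lamformDl lamformNl subrr. Qed.

Lemma lamform_suml s m I (r : seq I) (P : pred I) (f : I -> lattice U Fz) :
  lamform s (\sum_(i <- r | P i) f i) m = \sum_(i <- r | P i) lamform s (f i) m.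
Proof.
by apply: (big_morph (lamform s ^~ m)) => [x y|]; rewrite ?lamformDl ?lamform0l.
Qed.

Lemma lamformMzl s m1 m z : lamform s (m1 *~ z) m = lamform s m1 m *~ z.
Proof.
rewrite /lamform mulrz_suml; apply: eq_bigr => i _ /=.
rewrite mulrz_suml; apply: eq_bigr => j _; rewrite ffunMzE.
by rewrite !mulrzAl.
Qed.

End Lam.

Section Monomials.
Variables (c : flavour) (U Fz : finType) (F : unitAlgType (base c)).
Implicit Types (s : seed U Fz F) (m : lattice U Fz).

Lemma monomial0 s : monomial s 0 = 1.
Proof.
rewrite /monomial big1 => [|i _]; last by rewrite big1 // => j _; rewrite ffunE !mul0r.
by rewrite oppr0 qhalf0 scale1r big1 // => i _; rewrite ffunE expr0z.
Qed.

Lemma monomial_fvec s i : monomial s (fvec i) = var s i.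
Proof.
rewrite /monomial big1 => [|k _]; last first.
  apply: big1 => j kj; rewrite !ffunE.
  case: eqP => [ik|]; last by rewrite !mul0r.
  case: eqP => [ij|]; last by rewrite mulr0 mul0r.
  by move: kj; rewrite -ik ij ltnn.
rewrite oppr0 qhalf0 scale1r.
have: i \in enum {: U + Fz} by rewrite mem_enum.
have := enum_uniq {: U + Fz}; move: (enum _) => r r_uniq ri.
case/splitPr: ri r_uniq => p1 p2; rewrite cat_uniq /= negb_or -!andbA.
move=> /and5P[_ ip1 _ ip2 _].
have prod1 (r' : seq (U + Fz)) : i \notin r' ->
    \prod_(k <- r') var s k ^ fvec i k = 1.
  move=> ir'; rewrite big1_seq // => j /andP[_ jr']; rewrite ffunE.
  by case: eqP => [ij|_]; [rewrite ij jr' in ir' | rewrite expr0z].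
by rewrite big_cat big_cons /= !prod1 // mul1r mulr1 ffunE eqxx expr1z.
Qed.

(* The factor 2 compensates for the half powers of q counted by [qhalf]. *)
Definition qcommuting s := forall i j,
  var s i * var s j = qhalf c (lam s (i, j) *+ 2) *: (var s j * var s i).

Lemma qcommXz (x y : F) (e : int) (n : int) : x \is a GRing.unit ->
  x * y = qhalf c e *: (y * x) -> x ^ n * y = qhalf c (e * n) *: (y * x ^ n).
Proof.
move=> ux xy.
have posc (k : nat) : x ^+ k * y = qhalf c (e * k%:Z) *: (y * x ^+ k).
  elim: k => [|k IH]; first by rewrite !expr0 mulr0 qhalf0 mulr1 mul1r scale1r.
  rewrite exprS -mulrA IH -scalerAr [x * (y * _)]mulrA xy -scalerAl scalerA -mulrA; congr (_ *: _).
  by rewrite -qhalfD intS mulrDr mulr1 addrC.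
case: n => k; first exact: posc.
have uxk : x ^+ k.+1 \is a GRing.unit by rewrite unitrX.
rewrite NegzE -exprnN; apply: (mulrI uxk).
rewrite mulrA divrr // mul1r -scalerAr mulrA posc -scalerAl scalerA -qhalfD.
by rewrite -mulrA divrr // mulr1 -mulrDr subrr mulr0 qhalf0 scale1r.
Qed.

Lemma qcommXzXz (x y : F) (e m n : int) :
  x \is a GRing.unit -> y \is a GRing.unit ->
  x * y = qhalf c e *: (y * x) ->
  x ^ m * y ^ n = qhalf c (e * m * n) *: (y ^ n * x ^ m).
Proof.
move=> ux uy /(qcommXz m ux) xy.
have /(qcommXz n uy) yx : y * x ^ m = qhalf c (- (e * m)) *: (x ^ m * y).
  by rewrite xy scalerA -qhalfD addNr qhalf0 scale1r.
by rewrite yx scalerA -qhalfD mulNr subrr qhalf0 scale1r.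
Qed.

Section ProductLaw.
Variable s : seed U Fz F.
Hypotheses (s_unit : forall i, var s i \is a GRing.unit)
  (s_comm : qcommuting s) (s_skew : lam_skew s).

Lemma qcomm_prod (r : seq (U + Fz)) m i (a : int) :
  (\prod_(j <- r) var s j ^ m j) * var s i ^ a =
  qhalf c (\sum_(j <- r) lam s (j, i) * m j * a *+ 2) *:
    (var s i ^ a * \prod_(j <- r) var s j ^ m j).
Proof.
elim: r => [|k r IH]; first by rewrite !big_nil qhalf0 scale1r mulr1 mul1r.
rewrite !big_cons -mulrA IH -scalerAr [var s k ^ _ * (_ * _)]mulrA.
rewrite (qcommXzXz (m k) a (s_unit k) (s_unit i) (s_comm k i)).
rewrite -scalerAl scalerA -qhalfD [RHS]/= mulrA; congr (qhalf c _ *: _); ring.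
Qed.

Lemma sum_index_lt_cons (V : nmodType) (k : U + Fz) (r : seq (U + Fz))
    (f : U + Fz -> U + Fz -> V) : uniq (k :: r) ->
  \sum_(i <- k :: r) \sum_(j <- k :: r | (index i (k :: r) < index j (k :: r))%N) f i j
  = \sum_(j <- r) f k j
    + \sum_(i <- r) \sum_(j <- r | (index i r < index j r)%N) f i j.
Proof.
move=> /= /andP[kr ur]; rewrite big_cons; congr (_ + _).
  rewrite big_cons eqxx ltnn big_seq_cond [RHS]big_seq; apply: eq_bigl => j.
  case jr: (j \in r) => //=; case: eqP => // kj; by rewrite kj jr in kr.
rewrite big_seq [RHS]big_seq; apply: eq_bigr => i ir.
rewrite big_cons eqxx ltn0 big_seq_cond [RHS]big_seq_cond; apply: eq_bigl => j.
case jr: (j \in r) => //=; rewrite -if_neg.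
have -> : k != i by apply: contra kr => /eqP->.
rewrite -if_neg.
by have -> : k != j by apply: contra kr => /eqP->.
Qed.

(** Positions are compared by [index] in an arbitrary duplicate-free list, so that induction on the
    list is possible. *)
Lemma prodXzD (r : seq (U + Fz)) m m' : uniq r ->
  (\prod_(i <- r) var s i ^ m i) * (\prod_(i <- r) var s i ^ m' i) =
  qhalf c (\sum_(i <- r) \sum_(j <- r | (index i r < index j r)%N)
       lam s (j, i) * m j * m' i *+ 2) *:
  \prod_(i <- r) var s i ^ (m + m') i.
Proof.
elim: r => [|k r IH] ur.
  by rewrite !big_nil qhalf0 scale1r mulr1.
rewrite sum_index_lt_cons // big_cons [X in _ * X]big_cons big_cons.
case/andP: ur => kr ur.
rewrite mulrA -[_ * _ * var s k ^ _]mulrA qcomm_prod -scalerAr -scalerAl.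
rewrite mulrA -exprzDr // -mulrA (IH ur) -scalerAr scalerA qhalfD ffunE.
by [].
Qed.

(** The product law at a mutated seed is not given; it is derived from the q-commutation of the
    variables. Sorting the product contributes a sum over ordered pairs, which the normalizing
    factors in [monomial] turn into [lamform]. *)
Lemma qcomm_monomialM m m' :
  monomial s m * monomial s m' = qhalf c (lamform s m m') *: monomial s (m + m').
Proof.
(* This is the exponent in the normalization of [monomial]; by skew-symmetry [lamform] is its
   antisymmetrization. *)
pose f m1 m2 := \sum_i \sum_(j | (enum_rank i < enum_rank j)%N)
               m1 i * m2 j * lam s (i, j).
have fE (g : U + Fz -> U + Fz -> int) :
    \sum_(i <- enum {: U + Fz}) \sum_(j <- enum {: U + Fz} |
      (index i (enum {: U + Fz}) < index j (enum {: U + Fz}))%N) g i j =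
    \sum_i \sum_(j | (enum_rank i < enum_rank j)%N) g i j.
  have idx i : index i (enum {: U + Fz}) = enum_rank i.
    by rewrite -{1}(enum_rankK i) (enum_val_nth i) index_uniq ?enum_uniq // -cardE.
  rewrite big_enum; apply: eq_bigr => i _.
  by rewrite big_enum_cond; apply: eq_bigl => j; rewrite !idx.
have lam_ii i : lam s (i, i) = 0 by have := s_skew i i; lia.
have lamE : lamform s m m' = f m m' - f m' m.
  rewrite /lamform /f.
  under eq_bigr => i _ do
    rewrite (bigID (fun j => enum_rank i < enum_rank j)%N) /=.
  rewrite big_split /=; congr (_ + _).
  rewrite (exchange_big_dep xpredT) //= -sumrN.
  apply: eq_bigr => j _; rewrite -sumrN (bigD1 j) ?ltnn //= lam_ii mulr0 add0r.
  apply: eq_big => i; last by rewrite s_skew mulrN => _; rewrite [m i * _]mulrC.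
  by rewrite -leqNgt ltn_neqAle eq_sym andbC (inj_eq val_inj) (inj_eq enum_rank_inj).
have -> : monomial s m * monomial s m' =
    qhalf c (- f m m - f m' m') *:
    ((\prod_(i <- enum {: U + Fz}) var s i ^ m i)
     * (\prod_(i <- enum {: U + Fz}) var s i ^ m' i)).
  by rewrite /monomial -scalerAl -scalerAr scalerA -qhalfD.
rewrite prodXzD ?enum_uniq // scalerA -qhalfD /monomial scalerA -qhalfD.
congr (qhalf c _ *: _); rewrite lamE fE.
have -> : \sum_i \sum_(j | (enum_rank i < enum_rank j)%N)
    lam s (j, i) * m j * m' i *+ 2 = - f m' m *+ 2.
  rewrite -sumrN -sumrMnl; apply: eq_bigr => i _.
  rewrite -sumrN -sumrMnl; apply: eq_bigr => j _; rewrite s_skew; ring.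
have -> : \sum_i \sum_(j | (enum_rank i < enum_rank j)%N)
    (m + m') i * (m + m') j * lam s (i, j) =
    f m m + f m' m' + f m m' + f m' m.
  rewrite /f -!big_split; apply: eq_bigr => i _ /=.
  rewrite -!big_split; apply: eq_bigr => j _ /=; rewrite !ffunE; ring.
by ring.
Qed.

End ProductLaw.

Section Converse.
Variable s : seed U Fz F.
Hypotheses (s_skew : lam_skew s) (s_mul : forall m m',
  monomial s m * monomial s m' = qhalf c (lamform s m m') *: monomial s (m + m')).

Lemma monomial_mulN m : monomial s m * monomial s (- m) = 1.
Proof.
by rewrite s_mul raddfN /= lamformxx // oppr0 qhalf0 scale1r subrr monomial0.
Qed.

Lemma monomial_unit m : monomial s m \is a GRing.unit.
Proof.
apply/unitrP; exists (monomial s (- m)).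
split; last exact: monomial_mulN.
by have := monomial_mulN (- m); rewrite opprK.
Qed.

Lemma monomialC m m' : monomial s m * monomial s m' =
  qhalf c (lamform s m m' *+ 2) *: (monomial s m' * monomial s m).
Proof.
rewrite !s_mul scalerA -qhalfD addrC [m' + m]addrC; congr (qhalf c _ *: _).
by rewrite (lamformC m' m) //; ring.
Qed.

Lemma seed_mul_qcommuting : qcommuting s.
Proof. by move=> i j; rewrite -!monomial_fvec monomialC lamform_fvec. Qed.

End Converse.

End Monomials.

(** * Expansions in Laurent monomials *)

Section Lincomb.
Variables (c : flavour) (U Fz : finType) (F : unitAlgType (base c)).
Notation M := (lattice U Fz).
Notation fsM := {fsfun M -> base c with 0}.
Implicit Types (w : M -> F) (a b : fsM).

Lemma lincomb_sub w a (A : {fset M}) : finsupp a `<=` A ->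
  lincomb w a = \sum_(m <- A) a m *: w m.
Proof.
move=> sA; rewrite /lincomb; apply: big_fset_incl => // m _ ma.
by rewrite (fsfun_dflt ma) scale0r.
Qed.

(** The coefficients do not depend on [w], so they serve Laurent monomials and pointed elements
    alike. Since [e] may repeat values, they are sums over its fibres. *)
Lemma fsfun_sum (T : eqType) (r : seq T) (e : T -> M) (x : T -> base c) :
  exists a, (forall w, lincomb w a = \sum_(i <- r) x i *: w (e i)) /\
            forall q, a q = \sum_(i <- r) (e i == q)%:R * x i.
Proof.
pose A := [fset m in [seq e i | i <- r]].
pose a : fsM := [fsfun q in A => \sum_(i <- r) (e i == q)%:R * x i].
have aE q : a q = \sum_(i <- r) (e i == q)%:R * x i.
  rewrite fsfun_fun; case: ifP => // /negbT; rewrite !inE /= => qr.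
  elim: r qr {A a} => [|i r IH]; first by rewrite big_nil.
  rewrite /= inE negb_or => /andP[qi qr].
  by rewrite big_cons -IH // eq_sym (negPf qi) mul0r addr0.
exists a; split => // w; rewrite (@lincomb_sub _ _ A); last first.
  by apply/fsubsetP => m; apply: contraLR => mA; rewrite mem_finsupp fsfun_fun (negPf mA) eqxx.
under eq_bigr => q _ do rewrite aE scaler_suml.
rewrite exchange_big big_seq [RHS]big_seq; apply: eq_bigr => i ir.
have eA : e i \in A by rewrite !inE /= map_f.
rewrite (bigD1_seq (e i)) ?fset_uniq //= eqxx mul1r big1 ?addr0 // => q qi.
by rewrite eq_sym (negPf qi) mul0r scale0r.
Qed.

Lemma fsfun_lin (x : base c) a b :
  exists d : fsM, (forall w, lincomb w d = lincomb w a + x *: lincomb w b) /\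
            forall q, d q = a q + x * b q.
Proof.
pose A := finsupp a `|` finsupp b.
pose d : fsM := [fsfun q in A => a q + x * b q].
have dE q : d q = a q + x * b q.
  rewrite fsfun_fun; case: ifP => // /negbT; rewrite in_fsetU negb_or.
  by case/andP=> /fsfun_dflt-> /fsfun_dflt->; rewrite mulr0 addr0.
exists d; split => // w.
rewrite (@lincomb_sub w a A) ?fsubsetUl // (@lincomb_sub w b A) ?fsubsetUr //.
rewrite (@lincomb_sub w d A); last first.
  by apply/fsubsetP => m; apply: contraLR => mA; rewrite mem_finsupp fsfun_fun (negPf mA) eqxx.
rewrite scaler_sumr -big_split; apply: eq_bigr => q _ /=.
by rewrite dE scalerDl scalerA.
Qed.

End Lincomb.

Section Coefficients.
Variables (c : flavour) (U Fz : finType) (F : unitAlgType (base c)).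
Notation M := (lattice U Fz).
Notation fsM := {fsfun M -> base c with 0}.

(* Junk value 0 outside [LP s]. *)
Definition cf (s : seed U Fz F) (z : F) : fsM :=
  match pselect (exists a, z = lincomb (monomial s) a) with
  | left h => sval (cid h)
  | right _ => [fsfun]
  end.

Variable s : seed U Fz F.
Hypothesis s_free : lin_indep (monomial s).

Lemma cfP z : LP s z -> z = lincomb (monomial s) (cf s z).
Proof. by move=> zs; rewrite /cf; case: pselect => // h; case: cid. Qed.

Lemma lincomb_monomial_inj a b :
  lincomb (monomial s) a = lincomb (monomial s) b -> a = b.
Proof.
move=> e; apply/fsfunP => q; have [d [dl dE]] := fsfun_lin F (-1) a b.
have := s_free (a := d); rewrite dl e scaleN1r subrr => /(_ erefl q).
by rewrite dE mulN1r => /subr0_eq.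
Qed.

Lemma LP_lincomb a : LP s (lincomb (monomial s) a).
Proof. by exists a. Qed.

Lemma cf_lincomb a : cf s (lincomb (monomial s) a) = a.
Proof. by apply: lincomb_monomial_inj; rewrite -cfP //; exact: LP_lincomb. Qed.

Lemma cf_inj z z' : LP s z -> LP s z' -> cf s z =1 cf s z' -> z = z'.
Proof. by move=> /cfP-> /cfP->; rewrite !cf_lincomb => /fsfunP->. Qed.

Lemma cf_sum (T : eqType) (r : seq T) (e : T -> M) (x : T -> base c) :
  LP s (\sum_(i <- r) x i *: monomial s (e i)) /\
  forall q, cf s (\sum_(i <- r) x i *: monomial s (e i)) q
            = \sum_(i <- r) (e i == q)%:R * x i.
Proof.
have [a [al aE]] := fsfun_sum F r e x; rewrite -al; split; first exact: LP_lincomb.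
by move=> q; rewrite cf_lincomb.
Qed.

Lemma LP_lin x z z' : LP s z -> LP s z' -> LP s (z + x *: z').
Proof.
move=> /cfP-> /cfP->; have [d [dl _]] := fsfun_lin F x (cf s z) (cf s z').
by rewrite -dl; exact: LP_lincomb.
Qed.

Lemma cf_lin x z z' q : LP s z -> LP s z' ->
  cf s (z + x *: z') q = cf s z q + x * cf s z' q.
Proof.
move=> /cfP-> /cfP->; have [d [dl dE]] := fsfun_lin F x (cf s z) (cf s z').
by rewrite -dl !cf_lincomb.
Qed.

Lemma LP0 : LP s 0.
Proof.
by have [] := @cf_sum M [::] id (fun=> 0); rewrite big_nil.
Qed.

Lemma cf0 q : cf s 0 q = 0.
Proof. by have [_ /(_ q)] := @cf_sum M [::] id (fun=> 0); rewrite !big_nil. Qed.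

Lemma LPD z z' : LP s z -> LP s z' -> LP s (z + z').
Proof. by move=> hz hz'; rewrite -[z']scale1r; exact: LP_lin. Qed.

Lemma cfD z z' q : LP s z -> LP s z' -> cf s (z + z') q = cf s z q + cf s z' q.
Proof. by move=> hz hz'; rewrite -{1}[z']scale1r cf_lin // mul1r. Qed.

Lemma LPZ x z : LP s z -> LP s (x *: z).
Proof. by move=> hz; rewrite -[_ *: _]add0r; apply: LP_lin => //; exact: LP0. Qed.

Lemma cfZ x z q : LP s z -> cf s (x *: z) q = x * cf s z q.
Proof.
by move=> hz; rewrite -[_ *: _]add0r cf_lin // ?cf0 ?add0r //; exact: LP0.
Qed.

Lemma LPB z z' : LP s z -> LP s z' -> LP s (z - z').
Proof. by move=> hz hz'; rewrite -scaleN1r; exact: LP_lin. Qed.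

Lemma cfB z z' q : LP s z -> LP s z' -> cf s (z - z') q = cf s z q - cf s z' q.
Proof. by move=> hz hz'; rewrite -scaleN1r cf_lin // mulN1r. Qed.

Lemma LP_sum (T : Type) (r : seq T) (f : T -> F) :
  (forall i, LP s (f i)) -> LP s (\sum_(i <- r) f i).
Proof.
move=> h; elim: r => [|i r IH]; rewrite ?big_nil ?big_cons; first exact: LP0.
exact: LPD.
Qed.

Lemma cf_bigsum (T : Type) (r : seq T) (f : T -> F) q :
  (forall i, LP s (f i)) -> cf s (\sum_(i <- r) f i) q = \sum_(i <- r) cf s (f i) q.
Proof.
move=> h; elim: r => [|i r IH]; rewrite ?big_nil ?big_cons; first exact: cf0.
by rewrite cfD // ?IH //; exact: LP_sum.
Qed.

Lemma LP_monomial m : LP s (monomial s m).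
Proof.
have [] := @cf_sum _ [:: m] id (fun=> 1).
by rewrite big_seq1 scale1r.
Qed.

Lemma cf_monomial m q : cf s (monomial s m) q = (m == q)%:R.
Proof.
have [_ /(_ q)] := @cf_sum _ [:: m] id (fun=> 1).
by rewrite !big_seq1 scale1r mulr1.
Qed.

Lemma cf_neq0 z : LP s z -> z != 0 -> exists m, cf s z m != 0.
Proof.
move=> zs; apply: contraPP => /forallNP z0; apply/negP; rewrite negbK; apply/eqP.
by apply: cf_inj => //; [exact: LP0 | move=> q; rewrite cf0; apply/eqP/negPn/negP].
Qed.

Hypothesis s_mul : forall m m',
  monomial s m * monomial s m' = qhalf c (lamform s m m') *: monomial s (m + m').

Lemma LP_mulX m z : LP s z -> LP s (monomial s m * z).
Proof.
move=> /cfP->; rewrite /lincomb mulr_sumr; apply: LP_sum => i.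
by rewrite -scalerAr s_mul; do 2!apply: LPZ; exact: LP_monomial.
Qed.

Lemma cf_mulX m z q : LP s z ->
  cf s (monomial s m * z) q = qhalf c (lamform s m (q - m)) * cf s z (q - m).
Proof.
move=> zs; rewrite {1}(cfP zs) /lincomb mulr_sumr.
under eq_bigr => i _ do rewrite -scalerAr s_mul scalerA.
have [_ ->] := @cf_sum _ (finsupp (cf s z)) (fun i => m + i)
  (fun i => cf s z i * qhalf c (lamform s m i)).
have [qz|qz] := boolP (q - m \in finsupp (cf s z)); last first.
  rewrite (fsfun_dflt qz) mulr0 big1_seq // => i /andP[_ iz].
  case: eqP => [e|_]; last by rewrite mul0r.
  by case/negP: qz; rewrite -e addrC addKr.
rewrite (bigD1_seq (q - m)) ?fset_uniq //= [m + _]addrC subrK eqxx mul1r.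
rewrite big1 ?addr0 1?mulrC // => i iq.
case: eqP => [e|_]; last by rewrite mul0r.
by case/eqP: iq; rewrite -e addrC addKr.
Qed.

Lemma LPM z z' : LP s z -> LP s z' -> LP s (z * z').
Proof.
move=> /cfP-> z's; rewrite /lincomb mulr_suml; apply: LP_sum => i.
by rewrite -scalerAl; apply: LPZ; exact: LP_mulX.
Qed.

Lemma cfM z z' q : LP s z -> LP s z' -> cf s (z * z') q =
  \sum_(m <- finsupp (cf s z))
     cf s z m * (qhalf c (lamform s m (q - m)) * cf s z' (q - m)).
Proof.
move=> zs z's; rewrite {1}(cfP zs) /lincomb mulr_suml cf_bigsum.
  apply: eq_bigr => i _; rewrite -scalerAl cfZ ?cf_mulX //; exact: LP_mulX.
by move=> i; rewrite -scalerAl; apply: LPZ; exact: LP_mulX.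
Qed.

(** The support of a product lies in the Minkowski sum of the supports. *)
Lemma cfM_neq0 z z' q : LP s z -> LP s z' -> cf s (z * z') q != 0 ->
  exists m m', [/\ q = m + m', cf s z m != 0 & cf s z' m' != 0].
Proof.
move=> zs z's; rewrite cfM //; apply: contraPP => /forallNP h; apply/negP.
rewrite negbK big1_seq // => m /andP[_ mz]; apply/eqP.
have [->|z'm] := eqVneq (cf s z' (q - m)) 0; first by rewrite !mulr0.
case: (h m); exists (q - m); split; rewrite // -?mem_finsupp //.
by rewrite addrC subrK.
Qed.

End Coefficients.

(** * Mutation of exchange matrices and of seeds *)

Section ExchangeMatrices.
Variables (c : flavour) (U Fz : finType) (F : unitAlgType (base c)).
Variable d : U + Fz -> nat.
Hypothesis d_gt0 : forall i, (0 < d i)%N.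
Notation M := (lattice U Fz).
Notation Seed := (seed U Fz F).
Implicit Types (s : Seed) (k l : U) (m : M).

Definition col s k : M := [ffun i => bz s i (inl k)].

Definition integral s := forall i k, exch s (i, inl k) = (bz s i (inl k))%:~R.

Definition uskew s := forall k l,
  bz s (inl k) (inl l) * (d (inl l))%:Z = - (bz s (inl l) (inl k) * (d (inl k))%:Z).

Lemma uskew_diag s k : uskew s -> bz s (inl k) (inl k) = 0.
Proof. by move=> /(_ k k) h; have := d_gt0 (inl k); nia. Qed.

Lemma pos_part_int (n : int) : pos_part (n%:~R : rat) = (pos_part n)%:~R.
Proof.
by rewrite /pos_part !maxEle lerz0; case: ifP; rewrite ?mulr0z.
Qed.

Lemma pos_partE (n : int) : pos_part n = pos_part (- n) + n.
Proof. by rewrite /pos_part; lia. Qed.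

Lemma pos_partM (a : int) (x : nat) : pos_part a * x%:Z = pos_part (a * x%:Z).
Proof. by rewrite /pos_part maxr_pMl // mul0r. Qed.

Lemma uskew_pos s k l : uskew s ->
  pos_part (bz s (inl k) (inl l)) * (d (inl l))%:Z
  = pos_part (- bz s (inl l) (inl k)) * (d (inl k))%:Z.
Proof. by move=> /(_ k l) h; rewrite !pos_partM h mulNr. Qed.

Lemma bz_mutate s k i l : integral s ->
  bz (mutate s k) i (inl l) =
  if (i == inl k) || (l == k) then - bz s i (inl l)
  else bz s i (inl l) + bz s i (inl k) * pos_part (bz s (inl k) (inl l))
       + pos_part (- bz s i (inl k)) * bz s (inl k) (inl l).
Proof.
move=> si; rewrite {1}/bz ffunE /= (inj_eq inl_inj).
case: ifP => _; rewrite !si; first by rewrite -intrN intrKfloor.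
rewrite -intrN !pos_part_int -!intrM -!intrD. by rewrite intrKfloor.
Qed.

Lemma integral_mutate s k : integral s -> integral (mutate s k).
Proof.
move=> si i l; rewrite bz_mutate // ffunE /= (inj_eq inl_inj).
case: ifP => _; rewrite !si ?intrN //.
by rewrite -intrN !pos_part_int !intrD !intrM.
Qed.

Lemma uskew_mutate s k : integral s -> uskew s -> uskew (mutate s k).
Proof.
move=> si sk l n; rewrite !bz_mutate // !(inj_eq inl_inj).
rewrite [(n == k) || _]orbC; case: ifP => _; first by rewrite !mulNr sk.
(* For [lia] the products of matrix entries are atoms; the skew relations are therefore supplied
   already multiplied by the factors that occur. *)
have ln := sk l n.
have kn := congr1 ( *%R (pos_part (- bz s (inl l) (inl k)))) (sk k n).
have kl := congr1 ( *%R (pos_part (- bz s (inl n) (inl k)))) (sk k l).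
have pkn := congr1 ( *%R (bz s (inl l) (inl k))) (uskew_pos k n sk).
have pkl := congr1 ( *%R (bz s (inl n) (inl k))) (uskew_pos k l sk).
rewrite !mulrDl -!mulrA; lia.
Qed.

(* [false] gives the linear map used to transport lambda, [true] its mirror
   image; a valuation follows one or the other depending on a sign. *)
Definition spos (b : bool) (n : int) : int := pos_part (if b then n else - n).

Definition tauf s k b i : M :=
  if i == inl k then - fvec (inl k) + \sum_j fvec j *~ spos b (bz s j (inl k))
  else fvec i.

Definition tau s k b : M -> M := lin (tauf s k b).
HB.instance Definition _ s k b := GRing.Additive.copy (tau s k b) (lin (tauf s k b)).

Lemma sum_fvec (x : U + Fz -> int) i : (\sum_j fvec j *~ x j : M) i = x i.
Proof. by rewrite -[RHS](ffunE x) -[[ffun _ => _]]lin_id /lin; under [in RHS]eq_bigr do rewrite ffunE. Qed.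

Lemma tauE s k b m i : bz s (inl k) (inl k) = 0 ->
  tau s k b m i = if i == inl k then - m (inl k)
                  else m i + spos b (bz s i (inl k)) * m (inl k).
Proof.
move=> kk; rewrite /tau /lin sum_ffunE (bigD1 (inl k)) //= ffunMzE /tauf eqxx.
rewrite !ffunE sum_fvec [inl k == i]eq_sym; case: eqP => [->|/eqP ik].
  rewrite kk /spos if_same oppr0 ?if_same /pos_part maxxx addr0 mulNrz intz.
  rewrite big1 ?addr0 // => j jk; rewrite ffunMzE (negPf jk) ffunE (negPf jk).
  by rewrite mul0rz.
rewrite oppr0 add0r (bigD1 i) //= (negPf ik) ffunMzE ffunE eqxx intz.
rewrite big1 ?addr0 => [|j /andP[jk ji]]; first by rewrite addrC mulrzz.
by rewrite (negPf jk) ffunMzE ffunE (negPf ji) mul0rz.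
Qed.

Section Fixed.
Variables (s : Seed) (k : U).
Hypotheses (si : integral s) (sk : uskew s).
Let kk := uskew_diag k sk.

Lemma spos_opp b n : spos b (- n) = spos (~~ b) n.
Proof. by case: b; rewrite /spos //= opprK. Qed.

Lemma tauK b m : tau s k b (tau s k b m) = m.
Proof.
apply/ffunP => i; rewrite !tauE // eqxx; case: eqP => [->|_]; first by rewrite opprK.
by rewrite mulrN addrK.
Qed.

(** The difference of the two positive parts of an entry is the entry itself. Hence the two signs
    agree modulo the column, which is the common grading of the adjacent tori. *)
Lemma tau_true m : tau s k true m = tau s k false m + col s k *~ m (inl k).
Proof.
apply/ffunP => i; rewrite ffunE ffunMzE !tauE // !ffunE mulrzz.
case: eqP => [->|_]; first by rewrite kk mul0r addr0.
by rewrite /spos (pos_partE (bz s i (inl k))); ring.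
Qed.

Lemma tau_col b : tau s k b (col s k) = col s k.
Proof.
apply/ffunP => i; rewrite tauE // !ffunE kk mulr0 addr0 oppr0.
by case: eqP => // ->; rewrite kk.
Qed.

(** Mutation at [k] negates the [k]-th column, which exchanges the two signs. *)
Lemma tau_mutate b : tau (mutate s k) k b =1 tau s k (~~ b).
Proof.
have kk' : bz (mutate s k) (inl k) (inl k) = 0.
  by rewrite bz_mutate // !eqxx /= kk oppr0.
move=> m; apply/ffunP => i; rewrite !tauE //.
by rewrite bz_mutate // eqxx orbT spos_opp.
Qed.

Lemma tauFT m : tau s k false (tau s k true m) = m + col s k *~ m (inl k).
Proof.
rewrite tau_true raddfD /= tauK; congr (_ + _).
by rewrite raddfMz /= tau_col.
Qed.

Lemma col_mutate_same : col (mutate s k) k = - col s k.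
Proof. by apply/ffunP => i; rewrite !ffunE bz_mutate // eqxx orbT. Qed.

Lemma col_mutate b l : l != k -> tau s k b (col (mutate s k) l)
  = col s l + col s k *~ spos (~~ b) (bz s (inl k) (inl l)).
Proof.
move=> lk; apply/ffunP => i; rewrite tauE // !ffunE ffunMzE ffunE !bz_mutate //.
rewrite eqxx /= (negPf lk) orbF; case: eqP => [->|_].
  by rewrite kk mulrzz mul0r opprK addr0.
rewrite /spos mulrzz; case: b => /=; last by ring.
by rewrite (pos_partE (bz s (inl k) (inl l))) (pos_partE (bz s i (inl k))); ring.
Qed.

End Fixed.

Lemma exch_mutateK s k : exch (mutate (mutate s k) k) = exch s.
Proof.
have posE (x : rat) : pos_part x = pos_part (- x) + x.
  by rewrite /pos_part; case: (leP x 0); case: (leP (- x) 0); lra.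
apply/ffunP => -[i j]; rewrite !ffunE !eqxx /= !orbT.
have [->|ik] /= := eqVneq i (inl k); first by rewrite opprK.
have [->|jk] /= := eqVneq j (inl k); first by rewrite opprK.
rewrite opprK (posE (exch s (inl k, j))) (posE (exch s (i, inl k))); ring.
Qed.

(* A form of the full rank assumption that is easy to carry along mutations. *)
Definition dualizable s := forall w : U -> int,
  exists (L : int) (u : U + Fz -> int),
    0 < L /\ forall k, lin u (col s k) = L * w k.

(** It runs backwards because the rank assumption is made at the end of the mutation sequence. The
    functional is pulled back along [tau]. *)
Lemma dualizable_mutateP s k : integral s -> uskew s ->
  dualizable (mutate s k) -> dualizable s.
Proof.
move=> si sk dual w.
(* These are the values needed on the mutated columns, read off [col_mutate_same] and [col_mutate],
   for the pullback to have values proportional to [w]. *)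
pose w' l := if l == k then - w k else
  w l + spos true (bz s (inl k) (inl l)) * w k.
have [L [u' [L0 u'E]]] := dual w'.
pose f (m : M) := lin u' (tau s k false m).
have f_add : zmod_morphism f by move=> x y; rewrite /f !raddfB.
pose fA : {additive M -> int} :=
  HB.pack f (GRing.isZmodMorphism.Build _ _ f f_add).
exists L, (fun i => f (fvec i)); split=> // l.
have -> : lin (fun i => f (fvec i)) (col s l) = f (col s l).
  by rewrite -[in RHS](lin_id (col s l)); exact: (esym (lin_comp fA _ _)).
have fk : f (col s k) = L * w k.
  rewrite /f tau_col // -[col s k]opprK -col_mutate_same // raddfN /= u'E.
  by rewrite /w' eqxx mulrN opprK.
have [->//|lk] := eqVneq l k.
have := col_mutate si sk false lk => /(congr1 f).
have fDMz x y n : f (x + y *~ n) = f x + f y *~ n.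
  by rewrite (_ : f = fA :> (M -> int)) // raddfD raddfMz.
rewrite fDMz fk mulrzz /spos /= {1}/f tauK //.
rewrite u'E /w' (negPf lk) => e.
by apply: (addIr (pos_part (bz s (inl k) (inl l)) * (L * w k))); rewrite -mulrC -e; ring.
Qed.

Lemma full_rank_dualizable s : integral s -> full_rank s -> dualizable s.
Proof.
move=> si rk w.
have /row_fullP[C CB] : row_full (Btilde s) by rewrite /row_full rk.
pose W : 'rV[rat]_#|U| := \row_k (w (enum_val k))%:~R.
have [y yB] : exists y, y *m Btilde s = W.
  by exists (W *m C); rewrite -mulmxA CB mulmx1.
(* A common denominator of the rational solution [y]. *)
pose L := \prod_j denq (y ord0 j).
have Ly j : exists z : int, L%:~R * y ord0 j = z%:~R.
  exists ((\prod_(i | i != j) denq (y ord0 i)) * numq (y ord0 j)).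
  by rewrite /L (bigD1 j) //= !intrM numqE; ring.
have [z zE] := choice Ly.
exists L, (fun i => z (enum_rank i)); split.
  by apply: prodr_gt0 => i _; exact: denq_gt0.
move=> k; apply: (@intr_inj rat).
rewrite /lin rmorph_sum /= rmorphM /=.
have := congr1 (fun A : 'rV_ _ => A ord0 (enum_rank k)) yB.
rewrite !mxE [enum_val _](enum_rankK k) => <-; rewrite mulr_sumr.
rewrite (reindex enum_rank) /=; last by apply: onW_bij; exact: enum_rank_bij.
apply: eq_bigr => i _; rewrite mxE [X in exch s (X, _)](enum_rankK i).
rewrite [X in exch s (_, inl X)](enum_rankK k) si mulrA zE.
by rewrite ffunE mulrzz rmorphM.
Qed.

End ExchangeMatrices.

(** * Compatibility of lambda with the exchange matrix *)

Section LambdaCompatibility.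
Variables (c : flavour) (U Fz : finType) (F : unitAlgType (base c)).
Implicit Types (s : seed U Fz F) (k : U) (m : lattice U Fz).

(** Nonnegative rather than positive [e] lets the classical case, where lambda vanishes, be treated
    together with the quantum case. *)
Definition lam_compatible s := exists2 e : U -> int, forall k, 0 <= e k &
  forall m k, lamform s m (col s k) = - (m (inl k) * e k).

Lemma BvecE s (n : {ffun U -> nat}) : Bvec s n = \sum_k col s k *+ n k.
Proof.
apply/ffunP => i; rewrite sum_ffunE ffunE; apply: eq_bigr => k _.
by rewrite ffunMnE ffunE -natz mulr_natr.
Qed.

Lemma lamform_Bvec_compatible s (e : U -> int) : (forall k, 0 <= e k) ->
  (forall i k, lamform s (fvec i) (Bvec s [ffun l => (l == k : nat)])
               = - ((i == inl k)%:R * e k)) -> lam_compatible s.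
Proof.
move=> e0 eE; exists e => // m k.
have <- : Bvec s [ffun l => (l == k : nat)] = col s k.
  rewrite BvecE (bigD1 k) //= ffunE eqxx mulr1n big1 ?addr0 // => l lk.
  by rewrite ffunE (negPf lk) mulr0n.
rewrite -[in LHS](lin_id m) /lin lamform_suml.
under eq_bigr => i _ do rewrite lamformMzl eE.
rewrite (bigD1 (inl k)) //= eqxx big1 ?addr0; first by rewrite mul1r mulrzz; lia.
by move=> i ik; rewrite (negPf ik) mul0r oppr0 mul0rz.
Qed.

End LambdaCompatibility.

Lemma is_seed_lam (c : flavour) (U Fz : finType) (F : unitAlgType (base c))
    (d : U + Fz -> nat) (s : seed U Fz F) :
  is_seed d s -> lam_skew s /\ lam_compatible s.
Proof.
case: c F s => F s [_ _ /= lamP _ _ _].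
  split; first by move=> i j; rewrite lamP !ffunE oppr0.
  apply: (@lamform_Bvec_compatible _ _ _ _ _ (fun=> 0)) => // i k.
  rewrite /= mulr0 oppr0 /lamform big1 // => l _; rewrite big1 // => j _.
  by rewrite lamP !ffunE mulr0.
case: lamP => sk [d' [_ d'E]]; split=> //.
by apply: (lamform_Bvec_compatible (e := fun k => (d' k)%:Z)).
Qed.

(** * The quantum torus of a mutated seed, and involutivity of mutation *)

Section TorusSeeds.
Variables (c : flavour) (U Fz : finType) (F : unitAlgType (base c)).
Variable d : U + Fz -> nat.
Hypothesis d_gt0 : forall i, (0 < d i)%N.
Hypothesis F_division : division_ring F.
Notation M := (lattice U Fz).
Notation Seed := (seed U Fz F).
Implicit Types (s : Seed) (k l : U) (m : M).

Lemma seed_eq s s' : exch s = exch s' -> lam s = lam s' -> var s = var s' -> s = s'.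
Proof. by case: s s' => ? ? ? [? ? ?] /= -> -> ->. Qed.

(* What survives of [is_seed] and is needed at every seed of the mutation
   sequence; the fraction field condition is only used at its origin. *)
Record torus s : Prop := {
  torus_int : integral s;
  torus_uskew : uskew d s;
  torus_lam_skew : lam_skew s;
  torus_lam : lam_compatible s;
  torus_mul : forall m m', monomial s m * monomial s m'
                           = qhalf c (lamform s m m') *: monomial s (m + m');
  torus_free : lin_indep (monomial s) }.

Lemma is_seed_torus s : is_seed d s -> torus s.
Proof.
move=> ss; have [lsk lc] := is_seed_lam ss.
case: ss => sk int _ mul free _.
have si : integral s.
  by move=> i k; apply/esym/eqP; rewrite -intrEfloor; apply: int => ? ? [].
split => // k l; apply: (@intr_inj rat); rewrite intrN !intrM.
by rewrite -!si; exact: sk.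
Qed.

Section Mutation.
Variables (s : Seed) (k : U).
Hypothesis st : torus s.
Notation s' := (mutate s k).
Notation taum := (tau s k false).
Let si := torus_int st.
Let sk := torus_uskew st.
Let kk : bz s (inl k) (inl k) = 0 := uskew_diag d_gt0 k sk.
Let lsk := torus_lam_skew st.
Let mul := torus_mul st.

Lemma lamform_mutate m m' : lamform s' m m' = lamform s (taum m) (taum m').
Proof.
rewrite /tau /lin lamform_suml {1}/lamform; apply: eq_bigr => i _.
rewrite lamformMzl raddf_sum mulrz_suml; apply: eq_bigr => j _.
rewrite raddfMz /= ffunE /= /mut_fvec -![X in lamform s X]/(tauf s k false _).
rewrite -![X in lamform s _ X]/(tauf s k false _) !mulrzz; ring.
Qed.

Lemma lam_skew_mutate : lam_skew s'.
Proof. by move=> i j; rewrite -!lamform_fvec !lamform_mutate lamformC. Qed.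

(** The same [e] works: evaluating lambda on two columns in both orders shows that [e] makes the
    unfrozen block skew-symmetric, which matches the positive parts of opposite entries. *)
Lemma lam_compatible_mutate : lam_compatible s'.
Proof.
have [e e0 eE] := torus_lam st; exists e => // m l; rewrite lamform_mutate.
have [->|lk] := eqVneq l k.
  rewrite col_mutate_same // (raddfN (tau s k false)) /= (tau_col d_gt0) // raddfN /= eE.
  by rewrite tauE // eqxx mulNr !opprK.
rewrite (col_mutate d_gt0) // raddfD raddfMz /= !eE !tauE // eqxx (inj_eq inl_inj).
rewrite (negPf lk) /spos /= mulrzz.
have := eE (col s l) k; rewrite lamformC // eE !ffunE opprK => bb.
have : pos_part (bz s (inl k) (inl l)) * e k = pos_part (- bz s (inl l) (inl k)) * e l.
  by rewrite /pos_part !maxr_pMl // !mul0r; congr (Num.max _ _); lia.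
by move=> pp; have := congr1 ( *%R (m (inl k))) pp; lia.
Qed.

Lemma col_neq0 : dualizable s -> col s k != 0.
Proof.
move=> /(_ (fun=> 1))[L [u [L0 /(_ k)]]].
by case: eqP => // ->; rewrite raddf0; lia.
Qed.

Lemma monomial_mutate m : m (inl k) = 0 -> monomial s' m = monomial s m.
Proof.
move=> mk; rewrite /monomial; congr (qhalf c (- _) *: _).
  apply: eq_bigr => i _; apply: eq_bigr => j _; rewrite ffunE /= /mut_fvec.
  case: eqP => [->|_]; first by rewrite mk !mul0r.
  case: eqP => [->|_]; first by rewrite mk mulr0 !mul0r.
  by rewrite lamform_fvec.
apply: eq_bigr => i _; rewrite ffunE.
by case: eqP => // ->; rewrite mk !expr0z.
Qed.

Lemma var_mutate_same : var s' (inl k)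
  = monomial s (taum (fvec (inl k))) + monomial s (tau s k true (fvec (inl k))).
Proof. by rewrite ffunE eqxx /tau !lin_fvec /tauf eqxx. Qed.

Lemma var_mutate_neq i : i != inl k -> var s' i = var s i.
Proof. by move=> ik; rewrite ffunE (negPf ik). Qed.

Lemma tau_fvec b i : i != inl k -> tau s k b (fvec i) = fvec i.
Proof. by move=> ik; rewrite /tau lin_fvec /tauf (negPf ik). Qed.

Lemma tau_true_fvec : tau s k true (fvec (inl k)) = taum (fvec (inl k)) + col s k.
Proof. by rewrite (tau_true d_gt0) // ffunE eqxx. Qed.

(** The exponents of the two terms of the new variable differ by the column [k], which is
    lambda-orthogonal to every other basis vector. Both terms thus commute with another variable up
    to the same power of q. *)
Lemma qcommuting_mutate : qcommuting s'.
Proof.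
have [e _ eE] := torus_lam st.
have kj j : j != inl k -> var s' (inl k) * var s' j =
    qhalf c (lamform s (taum (fvec (inl k))) (fvec j) *+ 2) *:
     (var s' j * var s' (inl k)).
  move=> jk; rewrite (var_mutate_neq jk) var_mutate_same -(monomial_fvec s j).
  rewrite mulrDl mulrDr scalerDr (monomialC lsk mul (taum _)).
  congr (_ + _); rewrite (monomialC lsk mul); congr (qhalf c (_ *+ 2) *: _).
  rewrite tau_true_fvec lamformDl (lamformC (col s k)) // eE.
  by rewrite ffunE (negPf jk) mul0r !oppr0 addr0.
move=> i j; rewrite -[lam _ _]lamform_fvec lamform_mutate.
have [->|ik] := eqVneq i (inl k); have [->|jk] := eqVneq j (inl k).
- by rewrite lamformxx // mul0rn qhalf0 scale1r.
- by rewrite kj // (tau_fvec false jk).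
- by rewrite kj // (tau_fvec false ik) lamformC // scalerA -qhalfD -mulrnDl addNr mul0rn qhalf0 scale1r.
- by rewrite !var_mutate_neq // !(tau_fvec false ik, tau_fvec false jk) lamform_fvec (seed_mul_qcommuting lsk mul).
Qed.

(** The two exponents of the new variable differ by a nonzero column, so its two terms cannot
    cancel. *)
Lemma var_mutate_unit : dualizable s -> forall i, var s' i \is a GRing.unit.
Proof.
move=> dual i; have [->|ik] := eqVneq i (inl k); last first.
  by rewrite var_mutate_neq // -monomial_fvec; exact: monomial_unit.
apply: F_division; rewrite var_mutate_same tau_true_fvec.
set m := taum _.
have [_ h] := @cf_sum _ _ _ _ _ (torus_free st) _ [:: m; m + col s k] id (fun=> 1).
apply/negP => /eqP e0; have := h m; rewrite !big_cons !big_nil /= !scale1r !addr0 e0.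
rewrite cf0; last exact: torus_free.
rewrite eqxx -[X in _ == X]addr0 (inj_eq (addrI m)) (negPf (col_neq0 dual)).
by rewrite mul1r mul0r addr0 => /eqP; rewrite eq_sym oner_eq0.
Qed.

Lemma monomialM_mutate : dualizable s -> forall m m',
  monomial s' m * monomial s' m' = qhalf c (lamform s' m m') *: monomial s' (m + m').
Proof.
move=> dual; apply: qcomm_monomialM.
- exact: var_mutate_unit.
- exact: qcommuting_mutate.
- exact: lam_skew_mutate.
Qed.

Lemma torus_mutate : dualizable s -> lin_indep (monomial s') -> torus s'.
Proof.
move=> dual free; split => //.
- exact: integral_mutate.
- exact: uskew_mutate.
- exact: lam_skew_mutate.
- exact: lam_compatible_mutate.
- exact: monomialM_mutate.
Qed.

Lemma mutateK : dualizable s -> mutate s' k = s.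
Proof.
move=> dual; have [e _ eE] := torus_lam st.
have si' := integral_mutate k si; have sk' := uskew_mutate k si sk.
have kk' : bz s' (inl k) (inl k) = 0 := uskew_diag d_gt0 k sk'.
have tauT m : tau s' k false m = tau s k true m by apply: tau_mutate.
have tauF m : tau s' k true m = tau s k false m by apply: tau_mutate.
apply: seed_eq; first exact: exch_mutateK.
  apply/ffunP => -[i j]; rewrite [LHS]ffunE /= -[RHS]lamform_fvec.
  have fE n : mut_fvec s' k n = tau s k true (fvec n).
    by rewrite -tauT /tau lin_fvec.
  rewrite !fE lamform_mutate !(tauFT d_gt0) //.
  rewrite raddfD raddfMz /= !lamformDl !lamformMzl eE.
  rewrite (lamformC (col s k)) // eE (lamformxx (col s k)) // mul0rz.
  by rewrite mulrzz; lia.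
apply/ffunP => i; have [->|ik] := eqVneq i (inl k); last first.
  by rewrite !ffunE (negPf ik).
(* After left multiplication by the mutated variable, both sides are sums of monomials of exponent 0
   at [k], on which the two tori coincide. *)
have u' := var_mutate_unit dual (inl k); apply: (mulrI u').
rewrite -[var (mutate s' k) _]/(var (mutate s' k) (inl k)).
have -> : var (mutate s' k) (inl k) = monomial s' (tau s k true (fvec (inl k)))
                         + monomial s' (taum (fvec (inl k))).
  by rewrite ffunE eqxx -tauT -tauF /tau !lin_fvec /tauf eqxx.
rewrite -{1}monomial_fvec mulrDr !(monomialM_mutate dual).
rewrite var_mutate_same mulrDl -(monomial_fvec s) !mul addrC.
have [a0 a1] : (fvec (inl k) + taum (fvec (inl k))) (inl k) = 0 /\
   (fvec (inl k) + tau s k true (fvec (inl k))) (inl k) = 0.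
  by rewrite !ffunE !tauE // eqxx !ffunE eqxx.
rewrite !monomial_mutate // ![fvec _ + _]addrC !lamform_mutate (tauK d_gt0) //.
rewrite (tauFT d_gt0) // ffunE eqxx mulr1z; congr (_ + qhalf c _ *: _).
rewrite raddfD /= eE tau_true_fvec lamformDl; congr (_ + _).
by rewrite lamformC // eE tauE // eqxx !ffunE eqxx mulNr.
Qed.

End Mutation.
End TorusSeeds.

(** * Leading exponents as a valuation *)

Lemma finsupp_neq_nil (K : choiceType) (V : eqType) (x0 : V)
    (a : {fsfun K -> V with x0}) m : a m != x0 -> (finsupp a : seq K) != [::].
Proof.
move=> am; have h : m \in enum_fset (finsupp a) by rewrite mem_finsupp.
by apply: contraTneq h => ->.
Qed.

Section Valuation.
Variables (c : flavour) (U Fz : finType) (F : unitAlgType (base c)).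
Hypothesis F_division : division_ring F.
Notation M := (lattice U Fz).
Variable s0 : seed U Fz F.
Hypothesis s0_mul : forall m m',
  monomial s0 m * monomial s0 m' = qhalf c (lamform s0 m m') *: monomial s0 (m + m').
Hypothesis s0_free : lin_indep (monomial s0).
Hypothesis s0_frac :
  forall z, exists a b, [/\ LP s0 a, LP s0 b, b != 0 & z = a / b].
Variable P : pred M.
Hypothesis P0 : ~~ P 0.
Hypothesis PD : forall x y, P x -> P y -> P (x + y).
Hypothesis P_total : forall x, x != 0 -> P x || P (- x).

Lemma divring_mul_neq0 (x y : F) : x != 0 -> y != 0 -> x * y != 0.
Proof.
by move=> /F_division ux; apply: contra => /eqP e; rewrite -(mulrI_eq0 y (mulrI ux)) e.
Qed.

Lemma P_asym x y : P (x - y) -> P (y - x) -> False.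
Proof. by move=> h /(PD h); rewrite addrA subrK subrr (negPf P0). Qed.

Lemma max_exists (T : eqType) (r : seq T) (f : T -> M) : {in r &, injective f} ->
  r != [::] -> exists2 i, i \in r & forall j, j \in r -> j != i -> P (f i - f j).
Proof.
elim: r => // i [|i' r] IH inj _.
  by exists i; rewrite ?mem_head // => j; rewrite inE => /eqP->; rewrite eqxx.
have inj' : {in i' :: r &, injective f}.
  by move=> x y xr yr; apply: inj; rewrite inE ?xr ?yr orbT.
have [p pr pmax] := IH inj' isT.
have [pi|pi] := eqVneq p i.
  exists i; first exact: mem_head.
  move=> j; rewrite inE => /orP[/eqP->|jr]; first by rewrite eqxx.
  by rewrite -pi; exact: pmax.
have fpi : f p - f i != 0.
  rewrite subr_eq0; apply: contra pi => /eqP /inj-> //; first by rewrite inE pr orbT.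
  exact: mem_head.
case/orP: (P_total fpi) => h.
  exists p; first by rewrite inE pr orbT.
  by move=> j; rewrite inE => /orP[/eqP->//|jr]; exact: pmax.
exists i; first exact: mem_head.
move=> j; rewrite inE => /orP[/eqP->|jr _]; first by rewrite eqxx.
rewrite opprB in h; have [->//|jp] := eqVneq j p.
by have := PD h (pmax j jr jp); rewrite addrA subrK.
Qed.

(** [P] is the positive cone of a translation-invariant total order, so [P (p - q)] reads: q is
    smaller than p. *)
Definition is_lead (a : F) (p : M) := [/\ LP s0 a, cf s0 a p != 0
  & forall q, cf s0 a q != 0 -> q != p -> P (p - q)].

Lemma lead_exists a : LP s0 a -> a != 0 -> exists p, is_lead a p.
Proof.
move=> as0 a0; have [m am] := cf_neq0 s0_free as0 a0.
have : (finsupp (cf s0 a) : seq M) != [::].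
  exact: finsupp_neq_nil am.
move=> /(max_exists (f := id) (in2W (@inj_id M)))[p pa pmax].
exists p; split; rewrite // -?mem_finsupp // => q qa; apply: pmax.
by rewrite mem_finsupp.
Qed.

Lemma lead_inj a p p' : is_lead a p -> is_lead a p' -> p = p'.
Proof.
move=> [_ ap ap_max] [_ ap' ap'_max]; apply/eqP/negPn/negP => pp'.
have h := ap'_max p ap pp'; rewrite eq_sym in pp'.
exact: P_asym h (ap_max p' ap' pp').
Qed.

Lemma lead_neq0 a p : is_lead a p -> a != 0.
Proof. by case=> _ ap _; apply: contraNneq ap => ->; rewrite cf0. Qed.

(** Only the pair of leading exponents reaches [p + r], and its coefficient is nonzero because
    [base c] is a domain. *)
Lemma leadM a b p r : is_lead a p -> is_lead b r -> is_lead (a * b) (p + r).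
Proof.
move=> [as0 ap pmax] [bs0 br rmax]; split; first exact: LPM.
- rewrite cfM // (bigD1_seq p) ?mem_finsupp ?fset_uniq //=.
  rewrite [X in _ + X]big1_seq ?addr0.
    rewrite [p + r]addrC addrK.
    by apply: base_mul_neq0 => //; apply: base_mul_neq0 => //; exact: qhalf_neq0.
  move=> m /andP[mp]; rewrite mem_finsupp => am.
  have [->|bm] := eqVneq (cf s0 b (p + r - m)) 0; first by rewrite !mulr0.
  have h := pmax m am mp.
  have /(rmax _ bm) : p + r - m != r.
    by rewrite -subr_eq0 addrAC addrK subr_eq0 eq_sym.
  have -> : r - (p + r - m) = m - p by apply/ffunP => i; rewrite !ffunE; ring.
  by move=> /(P_asym h).
- move=> q /(cfM_neq0 s0_free s0_mul as0 bs0)[m [m' [-> am bm']]] neq.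
  rewrite opprD addrACA.
  have [e|mp] := eqVneq m p.
    rewrite e subrr add0r; apply: rmax => //.
    by apply: contraNneq neq => ->; rewrite e.
  have [->|mr] := eqVneq m' r; first by rewrite subrr addr0; exact: pmax.
  by apply: PD; [exact: pmax | exact: rmax].
Qed.

Lemma leadD a b p r : is_lead a p -> is_lead b r -> P (p - r) -> is_lead (a + b) p.
Proof.
move=> [as0 ap pmax] [bs0 br rmax] pr; split; first exact: LPD.
- rewrite cfD //; have [->|bp] := eqVneq (cf s0 b p) 0; first by rewrite addr0.
  have [e|neq] := eqVneq p r; first by move: pr; rewrite e subrr (negPf P0).
  by have /(P_asym pr) := rmax p bp neq.
- move=> q; rewrite cfD // => abq qp.
  have [aq|aq] := eqVneq (cf s0 a q) 0; last exact: pmax.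
  have bq : cf s0 b q != 0 by move: abq; rewrite aq add0r.
  have [->//|qr] := eqVneq q r.
  by have := PD pr (rmax q bq qr); rewrite addrA subrK.
Qed.

Lemma leadZ x a p : x != 0 -> is_lead a p -> is_lead (x *: a) p.
Proof.
move=> x0 [as0 ap pmax]; split; first exact: LPZ.
- by rewrite cfZ //; exact: base_mul_neq0.
- move=> q; rewrite cfZ // => xa; apply: pmax.
  by apply: contraNneq xa => ->; rewrite mulr0.
Qed.

Lemma lead_monomial m : is_lead (monomial s0 m) m.
Proof.
split; first exact: LP_monomial.
  by rewrite cf_monomial // eqxx oner_neq0.
move=> q; rewrite cf_monomial //; have [//|_] := eqVneq m q.
by rewrite eqxx.
Qed.

(** A relation, since a right fraction has many representatives; [val_inj] proves independence of
    the choice. *)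
Definition is_val (z : F) (m : M) := exists a b p r,
  [/\ is_lead a p, is_lead b r, z * b = a & m = p - r].

Lemma lead_val a p : is_lead a p -> is_val a p.
Proof.
move=> ap; exists a, 1, p, 0; rewrite mulr1 subr0; split => //.
by rewrite -(monomial0 s0); exact: lead_monomial.
Qed.

Lemma val_monomial m : is_val (monomial s0 m) m.
Proof. exact/lead_val/lead_monomial. Qed.

Lemma val_neq0 z m : is_val z m -> z != 0.
Proof.
move=> [a [b [p [r [ap _ za _]]]]]; apply: contraNneq (lead_neq0 ap) => z0.
by rewrite -za z0 mul0r.
Qed.

(** This is the Ore condition, obtained by writing the inverse of [a] times [b] as a right
    fraction. *)
Lemma right_common_multiple a p b r : is_lead a p -> is_lead b r ->
  exists x y q q', [/\ is_lead x q, is_lead y q', a * x = b * y & p + q = r + q'].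
Proof.
move=> ap br; have a0 := lead_neq0 ap; have b0 := lead_neq0 br.
have [x [y [xs ys y0 e]]] := s0_frac (a^-1 * b).
have ua := F_division a0; have uy := F_division y0.
have axby : a * x = b * y.
  by rewrite -[b](mulVKr ua) e mulrA mulrVK.
have x0 : x != 0.
  apply: contraTneq (divring_mul_neq0 b0 y0) => x0.
  by rewrite -axby x0 mulr0 eqxx.
have [q xq] := lead_exists xs x0; have [q' yq'] := lead_exists ys y0.
exists x, y, q, q'; split => //.
by apply: lead_inj (leadM ap xq) _; rewrite axby; exact: leadM.
Qed.

Lemma val_inj z m m' : is_val z m -> is_val z m' -> m = m'.
Proof.
move=> [a [b [p [r [ap br za ->]]]]] [a' [b' [p' [r' [ap' br' za' ->]]]]].
have [x [y [q [q' [xq yq' e eq]]]]] := right_common_multiple br br'.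
have : p + q = p' + q'.
  apply: lead_inj (leadM ap xq) _.
  by rewrite -za -mulrA e mulrA za'; exact: leadM.
move=> /(congr1 (fun x => x - (r + q))); rewrite {2}eq.
by rewrite !opprD ![_ + (- _ - _)]addrACA !subrr !addr0.
Qed.

Lemma valM z z' m m' : is_val z m -> is_val z' m' -> is_val (z * z') (m + m').
Proof.
move=> [a [b [p [r [ap br za ->]]]]] [a' [b' [p' [r' [ap' br' za' ->]]]]].
have [x [y [q [q' [xq yq' e eq]]]]] := right_common_multiple br ap'.
exists (a * x), (b' * y), (p + q), (r' + q'); split; try exact: leadM.
  by rewrite mulrA -[z * z' * _]mulrA za' -mulrA -e mulrA za.
have -> : p' = r + q - q' by rewrite eq addrK.
by apply/ffunP => i; rewrite !ffunE; ring.
Qed.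

Lemma valV z m : is_val z m -> is_val z^-1 (- m).
Proof.
move=> zm; have uz := F_division (val_neq0 zm).
case: zm => [a [b [p [r [ap br za ->]]]]].
by exists b, a, r, p; split; rewrite // ?opprB // -za mulKr.
Qed.

Lemma valZ x z m : x != 0 -> is_val z m -> is_val (x *: z) m.
Proof.
move=> x0 [a [b [p [r [ap br za ->]]]]].
by exists (x *: a), b, p, r; split => //; [exact: leadZ | rewrite -scalerAl za].
Qed.

Lemma valD z z' m m' : is_val z m -> is_val z' m' -> P (m - m') -> is_val (z + z') m.
Proof.
move=> [a [b [p [r [ap br za ->]]]]] [a' [b' [p' [r' [ap' br' za' ->]]]]] h.
have [x [y [q [q' [xq yq' e eq]]]]] := right_common_multiple br br'.
exists (a * x + a' * y), (b * x), (p + q), (r + q); split.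
- apply: leadD (leadM ap xq) (leadM ap' yq') _.
  suff -> : p + q - (p' + q') = p - r - (p' - r') by [].
  have -> : q = r' + q' - r by rewrite -eq addrC addKr.
  by apply/ffunP => i; rewrite !ffunE; ring.
- exact: leadM.
- by rewrite mulrDl mulrA za e mulrA za'.
- by rewrite opprD addrACA subrr addr0.
Qed.

Lemma val1 : is_val 1 0.
Proof. by rewrite -(monomial0 s0); exact: val_monomial. Qed.

Lemma valXz z m n : is_val z m -> is_val (z ^ n) (m *~ n).
Proof.
move=> zm; have valX (k : nat) : is_val (z ^+ k) (m *+ k).
  elim: k => [|k IH]; first by rewrite expr0 mulr0n; exact: val1.
  by rewrite exprS mulrS; exact: valM.
case: n => k; first exact: valX.
by rewrite NegzE -exprnN mulrNz; apply: valV; exact: valX.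
Qed.

Lemma val_seed_monomial s (psi : U + Fz -> M) m :
  (forall i, is_val (var s i) (psi i)) -> is_val (monomial s m) (lin psi m).
Proof.
move=> spsi; apply: valZ; first exact: qhalf_neq0.
rewrite /lin -big_enum /=; elim: (enum _) => [|i r IH].
  by rewrite !big_nil; exact: val1.
by rewrite !big_cons; apply: valM => //; exact: valXz.
Qed.

Lemma val_sum (T : eqType) (r : seq T) (x : T -> base c) (w : T -> F) (f : T -> M) :
  uniq r -> r != [::] -> {in r &, injective f} ->
  (forall i, i \in r -> x i != 0) -> (forall i, i \in r -> is_val (w i) (f i)) ->
  exists2 i, i \in r & is_val (\sum_(j <- r) x j *: w j) (f i).
Proof.
elim: r => // i [|i' r] IH ur _ inj x0 wf.
  exists i; first exact: mem_head.
  by rewrite big_seq1; apply: valZ; [apply: x0 | apply: wf]; exact: mem_head.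
have sub j : j \in i' :: r -> j \in [:: i, i' & r] by rewrite [in X in _ -> X]inE orbC => ->.
case/andP: ur => ir ur.
have [|||p pr pval] := IH ur isT.
- by move=> j j' jr j'r; apply: inj; exact: sub.
- by move=> j /sub; exact: x0.
- by move=> j /sub; exact: wf.
have ival : is_val (x i *: w i) (f i).
  by apply: valZ; [apply: x0 | apply: wf]; exact: mem_head.
rewrite big_cons; have : f i - f p != 0.
  rewrite subr_eq0; apply: contra ir => /eqP /inj-> //; first exact: mem_head.
  exact: sub.
move=> /P_total/orP[h|]; first by exists i; [exact: mem_head | exact: valD h].
rewrite opprB => h; exists p; first exact: sub.
by rewrite addrC; exact: valD h.
Qed.

Lemma val_lincomb (w : M -> F) (f : M -> M) (a : {fsfun M -> base c with 0}) :
  injective f -> (forall m, is_val (w m) (f m)) -> (exists m, a m != 0) ->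
  exists2 m, a m != 0 & is_val (lincomb w a) (f m).
Proof.
move=> inj wf [m am]; have [||||i ia iv] := @val_sum _ (finsupp a) a w f (fset_uniq _).
- exact: finsupp_neq_nil am.
- by move=> ? ? _ _; exact: inj.
- by move=> i; rewrite mem_finsupp.
- by move=> i _.
by exists i; rewrite // -mem_finsupp.
Qed.

(** A combination with a nonzero coefficient has a valuation, since distinct values prevent
    cancellation of the largest term; so it is nonzero. *)
Lemma val_free (w : M -> F) (f : M -> M) :
  injective f -> (forall m, is_val (w m) (f m)) -> lin_indep w.
Proof.
move=> inj wf a a0 m; apply/eqP/negPn/negP => am.
have [i _] := val_lincomb inj wf (ex_intro _ m am).
by rewrite a0 => /val_neq0; rewrite eqxx.
Qed.

End Valuation.

(** * Dominance orders *)

Section Dominance.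
Variables (c : flavour) (U Fz : finType) (F : unitAlgType (base c)).
Notation M := (lattice U Fz).
Notation Seed := (seed U Fz F).
Implicit Types (s : Seed) (m g h : M).

Lemma Bvec0 s : Bvec s [ffun=> 0%N] = 0.
Proof. by rewrite BvecE big1 // => k _; rewrite ffunE mulr0n. Qed.

Lemma BvecD s (n n' : {ffun U -> nat}) : Bvec s [ffun k => (n k + n' k)%N] = Bvec s n + Bvec s n'.
Proof.
by rewrite !BvecE -big_split; apply: eq_bigr => k _; rewrite ffunE mulrnDr.
Qed.

Lemma dom_le_refl s g : dom_le s g g.
Proof. by exists [ffun=> 0%N]; rewrite Bvec0 addr0. Qed.

Lemma dom_le_trans s g h m : dom_le s g h -> dom_le s h m -> dom_le s g m.
Proof.
move=> [n ->] [n' ->]; exists [ffun k => (n' k + n k)%N].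
by rewrite BvecD addrA.
Qed.

Lemma lin_Bvec s (V : zmodType) (f : {additive M -> V}) n :
  f (Bvec s n) = \sum_k f (col s k) *+ n k.
Proof. by rewrite BvecE raddf_sum; apply: eq_bigr => k _; rewrite raddfMn. Qed.

(** Each use of a column lowers the integer weight by at least 1. The resulting bound on every [n k]
    is what makes dominance intervals finite. *)
Lemma dom_weight s (f : {additive M -> int}) h n :
  (forall k, f (col s k) < 0) -> forall k, f (h + Bvec s n) + (n k)%:Z <= f h.
Proof.
move=> fs k; rewrite raddfD lin_Bvec -addrA gerDl (bigD1 k) //= addrAC.
rewrite -[X in _ <= X]addr0 lerD //.
  rewrite -mulr_natr natz -[X in _ + X]mul1r -mulrDl mulr_le0_ge0 //.
  by rewrite lezD1; exact: fs.
by apply: sumr_le0 => l _; apply: mulrn_wle0; exact: ltW.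
Qed.

Section Weight.
Variables (s : Seed) (f : {additive M -> int}).
Hypothesis fs : forall k, f (col s k) < 0.

Lemma dom_lt_weight g h : dom_lt s g h -> f g < f h.
Proof.
move=> [[n ->] neq].
have [k nk] : exists k, n k != 0%N.
  apply: contrapT => /forallNP n0; apply: neq.
  suff -> : n = [ffun=> 0%N] by rewrite Bvec0 addr0.
  by apply/ffunP => k; rewrite ffunE; apply/eqP/negPn/negP.
by have := dom_weight h n fs k; lia.
Qed.

Lemma dom_le_weight g h : dom_le s g h -> f g <= f h.
Proof.
move=> gh; have [->|/eqP neq] := eqVneq g h; first exact: lexx.
by apply/ltW/dom_lt_weight.
Qed.

Lemma dom_le_anti g h : dom_le s g h -> dom_le s h g -> g = h.
Proof.
move=> gh hg; apply: contrapT => neq; have := dom_le_weight hg.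
by have := dom_lt_weight (conj gh neq); lia.
Qed.

Lemma dom_maximal_above (A : {fset M}) (p : pred M) g : g \in A -> p g ->
  exists h, [/\ h \in A, p h, dom_le s g h &
    forall h', h' \in A -> p h' -> dom_le s h h' -> h' = h].
Proof.
have [N] := ubnP #|` [fset h in A | f g < f h]|.
elim: N g => // N IH g; rewrite ltnS => cardN gA pg.
have [[h' [h'A ph' gh' neq]]|none] := pselect (exists h',
    [/\ h' \in A, p h', dom_le s g h' & h' <> g]); last first.
  exists g; split => //; first exact: dom_le_refl.
  by move=> h' h'A ph' gh'; apply: contrapT => neq; apply: none; exists h'.
have lt_gh' : f g < f h' by apply: dom_lt_weight; split => // e; apply: neq.
have [|h [hA ph h'h hmax]] := IH h' _ h'A ph'; last first.
  by exists h; split => //; exact: dom_le_trans h'h.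
apply: leq_trans cardN; apply: fproper_ltn_card; rewrite fproperE; apply/andP; split.
  apply/fsubsetP => x; rewrite !inE /= => /andP[-> ]; exact: lt_trans.
apply/fsubsetPn; exists h'; first by rewrite !inE /= h'A.
by rewrite !inE /= ltxx andbF.
Qed.

(** In a finite support every exponent lies below a maximal one; if the maximal one is unique, it is
    the greatest. *)
Lemma degree_support z g a : expands_with_degree s z g a ->
  forall h, a h != 0 -> dom_le s h g.
Proof.
move=> [_ _ uniq] h; rewrite -mem_finsupp => ha.
have [h' [h'a _ hh' h'max]] := dom_maximal_above (p := predT) ha isT.
suff <- : h' = g by [].
apply: uniq; split => // q qa [h'q neq]; exact/neq/esym/h'max.
Qed.

Lemma pointed_support z g : lin_indep (monomial s) -> pointed s z g ->
  [/\ LP s z, cf s z g = 1 & forall h, cf s z h != 0 -> dom_le s h g].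
Proof.
move=> free [a za ag1]; case: (za) => zE _ _; rewrite zE cf_lincomb //.
by split => //; [exact: LP_lincomb | exact: degree_support za].
Qed.

End Weight.
End Dominance.

(** * Total orders refining the dominance order *)

Section LexOrder.
Variables U Fz : finType.
Notation M := (lattice U Fz).

Fixpoint lex_pos (r : seq int) : bool :=
  if r is x :: r' then (0 < x) || (x == 0) && lex_pos r' else false.

(* The total order refining the dominance order of a seed is obtained by
   comparing first a weight that is negative on the columns of the exchange
   matrix, then the coordinates. *)
Definition weight_pos (f : M -> int) : pred M :=
  fun m => lex_pos (f m :: [seq m i | i <- enum {: U + Fz}]).

Variable f : {additive M -> int}.

Lemma weight_pos0 : ~~ weight_pos f 0.
Proof.
rewrite /weight_pos /= raddf0 ltxx eqxx /=.
by elim: (enum _) => //= i r IH; rewrite ffunE ltxx eqxx.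
Qed.

Lemma weight_posD x y : weight_pos f x -> weight_pos f y -> weight_pos f (x + y).
Proof.
rewrite /weight_pos /= raddfD.
have step (a b : int) (p q r : bool) : (p -> q -> r) ->
    (0 < a) || (a == 0) && p -> (0 < b) || (b == 0) && q ->
    (0 < a + b) || (a + b == 0) && r.
  by case: p; case: q; case: r => [] h; rewrite ?andbT ?andbF ?orbF; try lia; have := h isT isT.
apply: (step); elim: (enum _) => //= i r IH; rewrite ffunE; exact: (step).
Qed.

Lemma weight_pos_total x : x != 0 -> weight_pos f x || weight_pos f (- x).
Proof.
move=> x0; have [i xi] : exists i, x i != 0.
  apply: contrapT => /forallNP h; case/eqP: x0; apply/ffunP => i.
  by rewrite ffunE; apply/eqP/negPn/negP.
rewrite /weight_pos /= raddfN.
have step (a : int) (p q : bool) : p || q ->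
    ((0 < a) || (a == 0) && p) || ((0 < - a) || (- a == 0) && q).
  by case: p; case: q => // _; rewrite ?andbT ?andbF ?orbF; lia.
apply: (step); have : i \in enum {: U + Fz} by rewrite mem_enum.
elim: (enum _) => //= j r IH; rewrite inE ffunE => /orP[/eqP<-|/IH]; last exact: (step).
have /orP[->|->] : (0 < x i) || (0 < - x i) by lia.
  by [].
by rewrite orbT.
Qed.

Lemma weight_pos_gt0 x : 0 < f x -> weight_pos f x.
Proof. by rewrite /weight_pos /= => ->. Qed.

End LexOrder.

(** * g- and c-matrices along a mutation sequence *)

Section Tracking.
Variables (c : flavour) (U Fz : finType) (F : unitAlgType (base c)).
Variable d : U + Fz -> nat.
Hypothesis d_gt0 : forall i, (0 < d i)%N.
Hypothesis F_division : division_ring F.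
Notation M := (lattice U Fz).
Notation Seed := (seed U Fz F).
Variable s0 : Seed.
Hypothesis s0_torus : torus d s0.
Hypothesis s0_dual : dualizable s0.
Hypothesis s0_frac :
  forall z, exists a b, [/\ LP s0 a, LP s0 b, b != 0 & z = a / b].
Variable P : pred M.
Hypothesis P0 : ~~ P 0.
Hypothesis PD : forall x y, P x -> P y -> P (x + y).
Hypothesis P_total : forall x, x != 0 -> P x || P (- x).
Implicit Types (s : Seed) (k l : U) (m : M).

(** Up to a common factor this is the inverse of [d (inl l)], kept integral: the duality of g- and
    c-vectors involves the inverse symmetrizer. *)
Definition codeg l : int := \prod_(l' | l' != l) (d (inl l'))%:Z.

Lemma codeg_gt0 l : 0 < codeg l.
Proof. by apply: prodr_gt0 => i _; rewrite ltz_nat. Qed.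

Lemma codeg_skew s k l : uskew d s ->
  bz s (inl k) (inl l) * codeg k = - (bz s (inl l) (inl k) * codeg l).
Proof.
move=> /(_ k l) h.
have E l' : codeg l' * (d (inl l'))%:Z = \prod_l (d (inl l))%:Z.
  by rewrite [RHS](bigD1 l') //= mulrC.
have D0 : \prod_l (d (inl l))%:Z != 0.
  by rewrite gt_eqF // prodr_gt0 // => i _; rewrite ltz_nat.
apply: (mulfI D0); transitivity
    (codeg k * codeg l * (bz s (inl k) (inl l) * (d (inl l))%:Z)).
  by rewrite -(E l); ring.
by rewrite h -(E k); ring.
Qed.

(* [psi] records the leading exponents of the cluster variables of [s] in the
   torus of [s0] (a g-matrix) and [C] those of the y-variables (a c-matrix).
   The last clause is the duality between g- and c-vectors; no sign-coherence
   is needed, the sign at each step being read off the total order. *)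
Record tracked s (psi : U + Fz -> M) (C : U -> U -> int) : Prop := {
  tracked_val : forall i, is_val s0 P (var s i) (psi i);
  tracked_frozen : forall i, psi (inr i) = fvec (inr i);
  tracked_col : forall k, lin psi (col s k) = \sum_l col s0 l *~ C k l;
  tracked_dual : forall m k,
    \sum_l lin psi m (inl l) * C k l * codeg l = m (inl k) * codeg k }.

Lemma tracked0 : tracked s0 (@fvec U Fz) (fun k l => (k == l)%:R).
Proof.
split => //.
- move=> i; rewrite -monomial_fvec; apply: val_monomial => //; exact: torus_free s0_torus.
- move=> k; rewrite lin_id (bigD1 k) //= eqxx mulr1z big1 ?addr0 // => l lk.
  by rewrite eq_sym (negPf lk) mulr0z.
- move=> m k; rewrite lin_id (bigD1 k) //= eqxx mulr1 big1 ?addr0 // => l lk.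
  by rewrite eq_sym (negPf lk) mulr0 mul0r.
Qed.

Lemma sum_col_eq0 (x : U -> int) : \sum_l col s0 l *~ x l = 0 -> forall k, x k = 0.
Proof.
move=> e k; have [L [u [L0 uE]]] := s0_dual (fun l => (l == k)%:R).
have := congr1 (lin u) e; rewrite raddf_sum raddf0 (bigD1 k) //= raddfMz /= uE eqxx.
rewrite big1 ?addr0 => [|l lk]; last by rewrite raddfMz /= uE (negPf lk) mulr0 mul0rz.
by rewrite mulr1 mulrzz => /eqP; rewrite mulf_eq0 gt_eqF //= => /eqP.
Qed.

Section Step.
Variables (s : Seed) (psi : U + Fz -> M) (C : U -> U -> int).
Hypotheses (st : torus d s) (str : tracked s psi C).
Let si := torus_int st.
Let sk := torus_uskew st.

Lemma tracked_inj : injective (lin psi).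
Proof.
suff inj m : lin psi m = 0 -> m = 0.
  by move=> x y /eqP; rewrite -subr_eq0 -raddfB => /eqP/inj/eqP; rewrite subr_eq0 => /eqP.
move=> m0; have mu k : m (inl k) = 0.
  have := tracked_dual str m k; rewrite big1 => [|l _]; last by rewrite m0 ffunE !mul0r.
  by move=> /esym/eqP; rewrite mulf_eq0 [codeg _ == _]gt_eqF ?codeg_gt0 // orbF => /eqP.
rewrite -m0 -[LHS]lin_id /lin; apply: eq_bigr => -[k|i] _.
  by rewrite mu !mulr0z.
by rewrite (tracked_frozen str).
Qed.

Lemma tracked_free : lin_indep (monomial s).
Proof.
have s0f := torus_free s0_torus; have s0m := torus_mul s0_torus.
apply: (val_free F_division s0m s0f s0_frac P0 PD P_total tracked_inj) => m.
exact/(val_seed_monomial F_division s0m s0f s0_frac P0 PD P_total)/(tracked_val str).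
Qed.

Lemma tracked_col_neq0 k : lin psi (col s k) != 0.
Proof.
apply/eqP; rewrite (tracked_col str) => /sum_col_eq0 C0.
have := tracked_dual str (fvec (inl k)) k; rewrite ffunE eqxx mul1r big1.
  by move=> e; have := codeg_gt0 k; rewrite -e ltxx.
by move=> l _; rewrite C0 mulr0 mul0r.
Qed.

Lemma tracked_mutate k : exists psi' C', tracked (mutate s k) psi' C'.
Proof.
have s0f := torus_free s0_torus; have s0m := torus_mul s0_torus.
have kk : bz s (inl k) (inl k) = 0 := uskew_diag d_gt0 k sk.
have vmon m : is_val s0 P (monomial s m) (lin psi m).
  exact/(val_seed_monomial F_division s0m s0f s0_frac P0 PD P_total)/(tracked_val str).
(* The leading exponents of the two terms of the exchange relation differ by this nonzero vector.
   Its sign selects the leading term and the version of the g- and c-recursions. *)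
pose b := P (lin psi (col s k)).
pose psi' i := lin psi (tau s k b (fvec i)).
have psi'E m : lin psi' m = lin psi (tau s k b m).
  rewrite -[in RHS](lin_id m) (lin_comp (tau s k b)) lin_comp.
  exact: eq_lin.
pose C' l n := if l == k then - C k n
               else C l n + spos (~~ b) (bz s (inl k) (inl l)) * C k n.
exists psi', C'; split.
- move=> i; have [->|ik] := eqVneq i (inl k); last first.
    rewrite var_mutate_neq // -monomial_fvec /psi' tau_fvec //.
  rewrite var_mutate_same /psi'.
  have v0 := vmon (tau s k false (fvec (inl k))).
  have v1 := vmon (tau s k true (fvec (inl k))).
  have e : lin psi (tau s k true (fvec (inl k)))
         = lin psi (tau s k false (fvec (inl k))) + lin psi (col s k).
    by rewrite (tau_true_fvec d_gt0 k st) raddfD.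
  have [h|h] := boolP b.
    rewrite addrC; apply: valD v1 v0 _ => //.
    by rewrite e addrAC subrr add0r.
  apply: valD v0 v1 _ => //; rewrite e opprD addrA subrr add0r.
  by have := P_total (tracked_col_neq0 k); rewrite -/b (negPf h).
- move=> i; rewrite /psi' tau_fvec // lin_fvec; exact: tracked_frozen str i.
- move=> l; rewrite psi'E /C'; have [->|lk] := eqVneq l k.
    rewrite col_mutate_same // raddfN /= (tau_col d_gt0) // raddfN /= (tracked_col str).
    by rewrite -sumrN; apply: eq_bigr => n _; rewrite mulrNz.
  rewrite (col_mutate d_gt0) // raddfD raddfMz /= !(tracked_col str).
  rewrite mulrz_suml -big_split; apply: eq_bigr => n _ /=.
  by rewrite mulrzDr mulrC mulrzA.
- move=> m l; have D := tracked_dual str (tau s k b m).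
  under eq_bigr => n _ do rewrite psi'E.
  rewrite /C'; have [->|lk] := eqVneq l k.
    under eq_bigr => n _ do rewrite mulrN mulNr.
    by rewrite sumrN D tauE // eqxx mulNr opprK.
  have E (a x y z w : int) : a * (x + y * z) * w = a * x * w + y * (a * z * w).
    by ring.
  under eq_bigr => n _ do rewrite E.
  rewrite big_split -mulr_sumr /= !D !tauE // eqxx (inj_eq inl_inj) (negPf lk).
  have := codeg_skew k l sk => cs.
  have : spos (~~ b) (bz s (inl k) (inl l)) * codeg k =
         spos b (bz s (inl l) (inl k)) * codeg l.
    rewrite /spos /pos_part !maxr_pMl ?(ltW (codeg_gt0 _)) // !mul0r.
    by case: (b); congr (Num.max _ _); rewrite /= ?mulNr; lia.
  by move=> e; have := congr1 ( *%R (m (inl k))) e; lia.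
Qed.

End Step.

Lemma dualizable_mutates s mu : integral s -> uskew d s ->
  dualizable (mutates s mu) -> dualizable s.
Proof.
elim: mu s => //= k mu IH s si sk h.
apply: (dualizable_mutateP d_gt0 (k := k)) => //; apply: IH => //.
  exact: integral_mutate.
exact: uskew_mutate.
Qed.

(** The two properties advance together: tracking one step needs the torus at the current seed, and
    tracking at the next seed gives the independence required of its torus. *)
Lemma tracked_mutates s mu psi C : torus d s -> tracked s psi C ->
  dualizable (mutates s mu) -> torus d (mutates s mu) /\
  exists psi' C', tracked (mutates s mu) psi' C'.
Proof.
elim: mu s psi C => [|k mu IH] s psi C st str dual; first by split; last by exists psi, C.
have [psi' [C' str']] := tracked_mutate st str k.
have sd : dualizable s.
  exact: dualizable_mutates (torus_int st) (torus_uskew st) dual.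
apply: (IH _ psi' C') => //; apply: torus_mutate => //; exact: tracked_free str'.
Qed.

End Tracking.

(** * Elements in the Laurent rings of two adjacent seeds *)

Section Supports.
Variables (c : flavour) (U Fz : finType) (F : unitAlgType (base c)).
Notation M := (lattice U Fz).
Notation Seed := (seed U Fz F).
Variable s : Seed.
Hypothesis s_free : lin_indep (monomial s).

Definition supported (Q : M -> Prop) (z : F) :=
  LP s z /\ forall m, cf s z m != 0 -> Q m.

Lemma supported_sub (Q Q' : M -> Prop) z :
  (forall m, Q m -> Q' m) -> supported Q z -> supported Q' z.
Proof. by move=> QQ' [zs zQ]; split=> // m /zQ/QQ'. Qed.

Lemma supportedD Q z z' : supported Q z -> supported Q z' -> supported Q (z + z').
Proof.
move=> [zs zQ] [z's z'Q]; split; first exact: LPD.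
move=> m; rewrite cfD //; have [e|/zQ//] := eqVneq (cf s z m) 0.
by rewrite e add0r => /z'Q.
Qed.

Lemma supportedZ Q x z : supported Q z -> supported Q (x *: z).
Proof.
move=> [zs zQ]; split; first exact: LPZ.
by move=> m; rewrite cfZ // => h; apply: zQ; apply: contraNneq h => ->; rewrite mulr0.
Qed.

Lemma supportedB Q z z' : supported Q z -> supported Q z' -> supported Q (z - z').
Proof. by move=> hz hz'; rewrite -scaleN1r; apply: supportedD => //; exact: supportedZ. Qed.

Lemma supported_sum Q (T : eqType) (r : seq T) (f : T -> F) :
  (forall i, i \in r -> supported Q (f i)) -> supported Q (\sum_(i <- r) f i).
Proof.
elim: r => [|i r IH] h.
  by rewrite big_nil; split; [exact: LP0 | move=> m; rewrite cf0 ?eqxx].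
rewrite big_cons; apply: supportedD; first by apply: h; exact: mem_head.
by apply: IH => j jr; apply: h; rewrite inE jr orbT.
Qed.

Lemma supported_disjoint (Q : M -> Prop) z :
  supported Q z -> supported (fun m => ~ Q m) z -> z = 0.
Proof.
move=> [zs zQ] [_ zQ']; apply: (cf_inj s_free) => //; first exact: LP0.
move=> m; rewrite cf0 //; apply/eqP/negPn/negP => h; exact: zQ' h (zQ m h).
Qed.

Lemma supported_split (Q : M -> Prop) z : LP s z -> exists z1 z2, [/\ z = z1 + z2,
  supported (fun m => cf s z m != 0 /\ Q m) z1 &
  supported (fun m => cf s z m != 0 /\ ~ Q m) z2].
Proof.
move=> zs; pose x m := if `[< Q m >] then cf s z m else 0.
have [z1s z1E] := cf_sum s_free (finsupp (cf s z)) id x.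
set z1 := \sum_(i <- _) _ in z1s z1E.
have {}z1E m : cf s z1 m = x m.
  rewrite z1E; have [mz|mz] := boolP (m \in finsupp (cf s z)).
    rewrite (bigD1_seq m) ?fset_uniq //= eqxx mul1r big1 ?addr0 // => i im.
    by rewrite (negPf im) mul0r.
  rewrite /x (fsfun_dflt mz) if_same big1_seq // => i /andP[_ iz].
  by case: eqP => [e|]; rewrite ?mul0r // -e iz in mz *.
exists z1, (z - z1); split; first by rewrite addrC subrK.
  by split=> // m; rewrite z1E /x; case: asboolP => // _; rewrite eqxx.
split; first exact: LPB.
move=> m; rewrite cfB // z1E /x; case: asboolP; first by rewrite subrr eqxx.
by rewrite subr0.
Qed.

Hypothesis s_mul : forall m m',
  monomial s m * monomial s m' = qhalf c (lamform s m m') *: monomial s (m + m').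

Lemma supportedM Q Q' z z' : supported Q z -> supported Q' z' ->
  supported (fun q => exists m m', [/\ q = m + m', Q m & Q' m']) (z * z').
Proof.
move=> [zs zQ] [z's z'Q]; split; first exact: LPM.
move=> q /(cfM_neq0 s_free s_mul zs z's)[m [m' [-> /zQ ? /z'Q ?]]].
by exists m, m'.
Qed.

End Supports.

(** * Homogeneous components and lowest layers at adjacent seeds *)

Section Adjacent.
Variables (c : flavour) (U Fz : finType) (F : unitAlgType (base c)).
Variable d : U + Fz -> nat.
Hypothesis d_gt0 : forall i, (0 < d i)%N.
Hypothesis F_division : division_ring F.
Notation M := (lattice U Fz).
Notation Seed := (seed U Fz F).
Implicit Types (g m : M) (Q : M -> Prop) (z : F).

Section OneSide.
Variables (s : Seed) (k : U).
Notation s' := (mutate s k).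
Hypotheses (st : torus d s) (s't : torus d s') (s_dual : dualizable s).
Notation v := (col s k).
Notation tauF := (tau s k false).
Notation tauT := (tau s k true).
Let si := torus_int st.
Let sk := torus_uskew st.
Let free := torus_free st.
Let mul := torus_mul st.
Let free' := torus_free s't.
Let mul' := torus_mul s't.
Let kk : bz s (inl k) (inl k) = 0 := uskew_diag d_gt0 k sk.

Lemma col_same : v (inl k) = 0.
Proof. by rewrite ffunE kk. Qed.

Lemma col_mul_inj (i j : int) : v *~ i = v *~ j -> i = j.
Proof.
have [L [u [L0 uE]]] := s_dual (fun=> 1).
move=> /(congr1 (lin u)); rewrite !raddfMz /= uE mulr1 !mulrzz.
by apply: mulfI; rewrite gt_eqF.
Qed.

Lemma trop_ge0 g : 0 <= g (inl k) -> trop s k g = tauT g.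
Proof.
move=> gk; apply/ffunP => i; rewrite ffunE tauE // /spos.
case: eqP => [->//|_]; rewrite (_ : pos_part (g (inl k)) = g (inl k)); last first.
  by rewrite /pos_part; lia.
by rewrite (_ : pos_part (- g (inl k)) = 0) ?mulr0 ?subr0 // /pos_part; lia.
Qed.

Lemma trop_le0 g : g (inl k) <= 0 -> trop s k g = tauF g.
Proof.
move=> gk; apply/ffunP => i; rewrite ffunE tauE // /spos.
case: eqP => [->//|_]; rewrite (_ : pos_part (g (inl k)) = 0); last first.
  by rewrite /pos_part; lia.
rewrite (_ : pos_part (- g (inl k)) = - g (inl k)); last by rewrite /pos_part; lia.
by rewrite mulr0 addr0 mulrN opprK.
Qed.

Lemma trop_inj : injective (trop s k).
Proof.
move=> g h e; have ek := congr1 (fun m : M => m (inl k)) e; rewrite /= !ffunE eqxx in ek.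
have {}ek : g (inl k) = h (inl k) by exact: oppr_inj.
have [gk|gk] := leP 0 (g (inl k)).
  by move: e; rewrite !trop_ge0 -?ek // => /(can_inj (tauK d_gt0 k sk true)).
by move: e; rewrite !trop_le0 -?ek ?ltW // => /(can_inj (tauK d_gt0 k sk false)).
Qed.

Lemma tauF_fixed m : m (inl k) = 0 -> tauF m = m.
Proof.
move=> mk; apply/ffunP => i; rewrite tauE // mk mulr0 addr0 oppr0.
by case: eqP => // ->.
Qed.

Lemma tauFT_col m : tauF (tauT m) = m + v *~ m (inl k).
Proof. exact: tauFT. Qed.

Lemma var_mutated_back :
  var s (inl k) = monomial s' (tauT (fvec (inl k))) + monomial s' (tauF (fvec (inl k))).
Proof.
rewrite -{1}(mutateK d_gt0 F_division k st s_dual) var_mutate_same.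
by rewrite !(tau_mutate d_gt0 _ si sk).
Qed.

(** The variable at [k] is a binomial in the mutated torus, so its [a]-th power gives a string of
    exponents of length [a] along the column. Only the nonvanishing of the far end, [tauT m], is
    recorded, which avoids q-binomial coefficients. *)
Lemma monomial_expand (a : nat) m : m (inl k) = a ->
  [/\ LP s' (monomial s m),
      forall m', cf s' (monomial s m) m' != 0 ->
        exists2 i, (i <= a)%N & tauF m' = m + v *+ i
    & cf s' (monomial s m) (tauT m) != 0].
Proof.
elim: a m => [|a IH] m mk.
  have tauT_m : tauT m = m by rewrite (tau_true d_gt0) // mk mulr0z addr0 tauF_fixed.
  rewrite -(@monomial_mutate _ _ _ _ s k) // tauT_m; split.
  - exact: LP_monomial.
  - move=> m'; rewrite cf_monomial //; case: (m =P m') => [<-|]; last by rewrite eqxx.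
    by exists 0%N; rewrite // mulr0n addr0 tauF_fixed.
  - by rewrite cf_monomial // eqxx oner_neq0.
pose fk : M := fvec (inl k).
have mfk : (m - fk) (inl k) = a by rewrite !ffunE eqxx mk; lia.
have [X1s X1supp X1top] := IH _ mfk.
set X1 := monomial s (m - fk) in X1s X1supp X1top.
have XE : monomial s m = qhalf c (- lamform s fk (m - fk)) *: (var s (inl k) * X1).
  rewrite -(monomial_fvec s) mul scalerA -qhalfD addNr qhalf0 scale1r.
  by rewrite addrC subrK.
rewrite var_mutated_back mulrDl in XE.
have [As Bs] : LP s' (monomial s' (tauT fk) * X1) /\ LP s' (monomial s' (tauF fk) * X1).
  by split; exact: LP_mulX.
have cfE q : cf s' (monomial s m) q = qhalf c (- lamform s fk (m - fk)) *
   (qhalf c (lamform s' (tauT fk) (q - tauT fk)) * cf s' X1 (q - tauT fk)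
   + qhalf c (lamform s' (tauF fk) (q - tauF fk)) * cf s' X1 (q - tauF fk)).
  by rewrite XE cfZ ?cfD ?cf_mulX //; exact: LPD.
have Ffk : tauF (tauF fk) = fk by rewrite (tauK d_gt0).
have Tfk : tauF (tauT fk) = fk + v by rewrite tauFT_col ffunE eqxx mulr1z.
split.
- by rewrite XE; apply: LPZ => //; exact: LPD.
- move=> q; rewrite cfE => h.
  have /orP[/X1supp[i ia]|/X1supp[i ia]] :
      (cf s' X1 (q - tauT fk) != 0) || (cf s' X1 (q - tauF fk) != 0).
    rewrite -negb_and; apply: contraNN h => /andP[/eqP-> /eqP->].
    by rewrite !mulr0 addr0 mulr0.
  + rewrite raddfB /= Tfk => /eqP; rewrite subr_eq => /eqP->.
    exists i.+1 => //; rewrite mulrS -addrA [_ *+ i + _]addrC addrA.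
    by rewrite [fk + v]addrC; apply/ffunP => j; rewrite !ffunE; ring.
  + rewrite raddfB /= Ffk => /eqP; rewrite subr_eq => /eqP->.
    exists i; first exact: leqW.
    by rewrite addrAC subrK.
- rewrite cfE -raddfB /=.
  (* The other term of the binomial could reach [tauT m] only from step a + 1 of a string that stops
     at a. *)
  have [->|/X1supp[i ia]] := eqVneq (cf s' X1 (tauT m - tauF fk)) 0.
    rewrite mulr0 addr0; apply: base_mul_neq0; first exact: qhalf_neq0.
    by apply: base_mul_neq0 => //; exact: qhalf_neq0.
  rewrite raddfB /= Ffk tauFT_col mk addrAC => /addrI.
  by rewrite pmulrn => /col_mul_inj []; lia.
Qed.

Definition col_invariant (Q : M -> Prop) := forall m, Q (m + v) <-> Q m.

Lemma col_invariantMn Q m i : col_invariant Q -> (Q (m + v *+ i) <-> Q m).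
Proof.
move=> inv; elim: i => [|i IH]; first by rewrite mulr0n addr0.
by rewrite mulrSr addrA inv.
Qed.

Lemma supported_mutate Q z : col_invariant Q ->
  supported s (fun m => 0 <= m (inl k) /\ Q m) z ->
  supported s' (fun m' => Q (tauF m')) z.
Proof.
move=> inv [zs zQ]; rewrite (cfP zs); apply: supported_sum => // m mz.
rewrite mem_finsupp in mz; have [mk Qm] := zQ m mz; apply: supportedZ => //.
have mk' : m (inl k) = `|m (inl k)|%N :> int by rewrite gez0_abs.
have [Xs Xsupp _] := monomial_expand mk'; split => // m' /Xsupp[i _ ->].
exact/col_invariantMn.
Qed.

Lemma exponent_bound z : exists a : nat, forall m, cf s z m != 0 -> 0 <= m (inl k) + a%:Z.
Proof.
exists (\sum_(m <- finsupp (cf s z)) `|m (inl k)|)%N => m mz.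
have : (`|m (inl k)| <= \sum_(m <- finsupp (cf s z)) `|m (inl k)|)%N.
  by rewrite (bigD1_seq m) ?mem_finsupp ?fset_uniq //= leq_addr.
lia.
Qed.

(* Both tori are graded by the lattice modulo the column [v]; multiplying by a
   power of [x_k] brings an element of the first torus into the second. *)
Lemma homogeneous_unique Q z1 z2 z1' z2' : col_invariant Q ->
  supported s Q z1 -> supported s (fun m => ~ Q m) z2 ->
  supported s' (fun m => Q (tauF m)) z1' ->
  supported s' (fun m => ~ Q (tauF m)) z2' ->
  z1 + z2 = z1' + z2' -> z1 = z1'.
Proof.
move=> inv z1Q z2Q z1'Q z2'Q e.
have [a1 a1P] := exponent_bound z1; have [a2 a2P] := exponent_bound z2.
(* This power of the variable at [k] clears its negative exponents in both [z1] and [z2]. *)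
pose a := (a1 + a2)%N; pose fa : M := fvec (inl k) *+ a.
have fak : fa (inl k) = a by rewrite ffunMnE ffunE eqxx mulr1n natz.
pose A := monomial s fa.
have uA : A \is a GRing.unit by exact: monomial_unit (torus_lam_skew st) mul _.
pose Q1 m := Q (m - fa).
have inv1 : col_invariant Q1 by move=> m; rewrite /Q1 addrAC; exact: inv.
have invN (R : M -> Prop) : col_invariant R -> col_invariant (fun m => ~ R m).
  by move=> h m; split=> hm /h.
have As : supported s (fun m => m = fa) A.
  split; first exact: LP_monomial.
  by move=> m; rewrite cf_monomial //; case: (fa =P m) => // _; rewrite eqxx.
have As' : supported s' (fun m' => exists i, tauF m' = fa + v *+ i) A.
  have [? h _] := monomial_expand fak; split => // m' /h[i _ ->]; by exists i.
have side (R : M -> Prop) z : col_invariant R -> supported s R z ->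
    (forall m, cf s z m != 0 -> 0 <= m (inl k) + a%:Z) ->
    supported s' (fun m' => R (tauF m' - fa)) (A * z).
  move=> invR [zs zR] za; apply: (@supported_mutate (fun m => R (m - fa))).
    by move=> m; rewrite addrAC; exact: invR.
  have zR' : supported s (fun m => cf s z m != 0) z by split.
  apply: supported_sub (supportedM free mul As zR') => q [m [m' [-> -> h]]].
  split; first by rewrite ffunE fak addrC; exact: za.
  by rewrite addrC addKr; exact: zR.
have side' (R : M -> Prop) z : col_invariant R -> supported s' (fun m => R (tauF m)) z ->
    supported s' (fun m' => R (tauF m' - fa)) (A * z).
  move=> invR zR; apply: supported_sub (supportedM free' mul' As' zR).
  move=> q [m [m' [-> [i mi] Rm']]].
  rewrite raddfD /= mi (_ : _ - fa = tauF m' + v *+ i); first exact/col_invariantMn.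
  by apply/ffunP => j; rewrite !ffunE; ring.
have b1 m : cf s z1 m != 0 -> 0 <= m (inl k) + a%:Z.
  by move=> /a1P h; rewrite /a PoszD addrA addr_ge0.
have b2 m : cf s z2 m != 0 -> 0 <= m (inl k) + a%:Z.
  by move=> /a2P h; rewrite /a PoszD addrCA addr_ge0.
have h1 := side _ _ inv z1Q b1; have h2 := side _ _ (invN _ inv) z2Q b2.
have h1' := side' _ _ inv z1'Q; have h2' := side' _ _ (invN _ inv) z2'Q.
(* The left side is supported where the shifted [Q] holds and the right side where it fails, so both
   vanish. *)
have e' : A * z1 - A * z1' = A * z2' - A * z2.
  by apply/eqP; rewrite subr_eq addrAC eq_sym subr_eq -!mulrDr [z2' + _]addrC e.
apply: (mulrI uA); apply/eqP; rewrite -subr_eq0; apply/eqP.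
apply: (supported_disjoint free' (Q := fun m' => Q (tauF m' - fa))).
  exact: supportedB.
by rewrite e'; exact: supportedB.
Qed.

(** Splitting the two expansions independently produces the same pieces, by [homogeneous_unique];
    each piece therefore lies in both Laurent rings. *)
Lemma homogeneous_split Q z : col_invariant Q -> LP s z -> LP s' z ->
  exists z1 z2, [/\ z = z1 + z2,
    supported s (fun m => cf s z m != 0 /\ Q m) z1,
    supported s' (fun m => cf s' z m != 0 /\ Q (tauF m)) z1,
    supported s (fun m => cf s z m != 0 /\ ~ Q m) z2 &
    supported s' (fun m => cf s' z m != 0 /\ ~ Q (tauF m)) z2].
Proof.
move=> inv zs zs'.
have [z1 [z2 [e z1Q z2Q]]] := supported_split free Q zs.
have [z1' [z2' [e' z1'Q z2'Q]]] := supported_split free' (fun m => Q (tauF m)) zs'.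
have e1 : z1 = z1'.
  apply: (@homogeneous_unique Q z1 z2 z1' z2') => //; last by rewrite -e.
  - by apply: supported_sub z1Q => m [].
  - by apply: supported_sub z2Q => m [].
  - by apply: supported_sub z1'Q => m [].
  - by apply: supported_sub z2'Q => m [].
have e2 : z2 = z2' by apply: (addrI z1); rewrite -e e' e1.
by exists z1, z2; split => //; [rewrite e1 | rewrite e2].
Qed.

Section Layers.
Variable f : {additive M -> int}.
Hypotheses (fv : f v = 0) (f_gt0 : forall l, l != k -> 0 < f (col s l)).

(** As [f] is positive on every other column, the dominance order inside one layer moves along [v]
    only. *)
Lemma layer_Bvec n : f (Bvec s n) <= 0 -> Bvec s n = v *+ n k.
Proof.
rewrite lin_Bvec (bigD1 k) //= fv mul0rn add0r => h.
have n0 l : l != k -> n l = 0%N.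
  move=> lk; apply/eqP/negPn/negP => nl; move: h; apply/negP; rewrite -ltNge.
  rewrite (bigD1 l) //= ltr_wpDr //.
    by apply: sumr_ge0 => i /andP[ik _]; rewrite mulrn_wge0 // ltW // f_gt0.
  by rewrite pmulrn_lgt0 ?f_gt0 // lt0n.
rewrite BvecE (bigD1 k) //= big1 ?addr0 // => l lk.
by rewrite n0.
Qed.

Lemma layer_Bvec_mutate n : f (tauF (Bvec s' n)) <= 0 -> tauF (Bvec s' n) = - (v *+ n k).
Proof.
have fcol l : l != k -> 0 < f (tauF (col s' l)).
  by move=> lk; rewrite (col_mutate d_gt0) // raddfD raddfMz /= fv mul0rz addr0 f_gt0.
have colk : tauF (col s' k) = - v.
  by rewrite col_mutate_same // raddfN /= (tau_col d_gt0).
rewrite lin_Bvec raddf_sum (bigD1 k) //= raddfMn /= colk raddfMn raddfN /= fv oppr0.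
rewrite mul0rn add0r => h.
have n0 l : l != k -> n l = 0%N.
  move=> lk; apply/eqP/negPn/negP => nl; move: h; apply/negP; rewrite -ltNge.
  rewrite (bigD1 l) //= ltr_wpDr //.
    by apply: sumr_ge0 => i /andP[ik _]; rewrite !raddfMn mulrn_wge0 // ltW // fcol.
  by rewrite !raddfMn pmulrn_lgt0 ?fcol // lt0n.
rewrite (bigD1 k) //= colk mulNrn big1 ?addr0 // => l lk.
by rewrite n0.
Qed.

(* The lowest layer of an element pointed at [g] in both seeds compatibly is
   the Laurent monomial [x ^ g] itself: any longer string of exponents
   [g + i v] would have too large a degree in the mutated seed. *)
Lemma pointed_lowest_layer g z : LP s z -> LP s' z -> 0 <= g (inl k) ->
  cf s z g = 1 -> (forall h, cf s z h != 0 -> dom_le s h g) ->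
  (forall h, cf s' z h != 0 -> dom_le s' h (trop s k g)) ->
  supported s (fun m => f g < f m) (z - monomial s g) /\
  supported s' (fun m => f g < f (tauF m)) (z - monomial s g).
Proof.
move=> zs zs' gk zg zdom zdom'; pose Q m := f m <= f g.
have invQ : col_invariant Q by move=> m; rewrite /Q raddfD /= fv addr0.
have [z1 [z2 [e z1s z1s' z2s z2s']]] := homogeneous_split invQ zs zs'.
suff z1E : z1 = monomial s g.
  rewrite e z1E addrAC subrr add0r; split.
    by apply: supported_sub z2s => m [_ /negP]; rewrite -ltNge.
  by apply: supported_sub z2s' => m [_ /negP]; rewrite -ltNge.
case: z1s => z1s z1Q; case: z2s => z2s z2Q; case: z1s' => z1s' z1Q'.
have z1g : cf s z1 g = 1.
  have : cf s z2 g = 0.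
    by apply/eqP/negPn/negP => /z2Q[_]; apply; exact: lexx.
  by move=> z20; move: zg; rewrite e cfD // z20 addr0.
have string m : cf s z1 m != 0 -> exists i : nat, m = g + v *+ i.
  move=> /z1Q[/zdom[n ->]]; rewrite /Q raddfD /= gerDl => /layer_Bvec->.
  by exists (n k).
(* The weight [w] is positive on [v]; maximizing the order it defines picks the far end [p] of the
   string. *)
have [L [w [L0 wE]]] := s_dual (fun l => (l == k)%:R).
have wv : lin w v = L by rewrite wE eqxx mulr1.
have z1g0 : cf s z1 g != 0 by rewrite z1g oner_neq0.
have [p pz1 pmax] := max_exists (weight_posD (f := lin w))
  (weight_pos_total (lin w)) (f := id) (in2W (@inj_id M)) (finsupp_neq_nil z1g0).
rewrite mem_finsupp in pz1; have [i pE] := string p pz1.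
have top m : cf s z1 m != 0 -> m != p -> exists2 j, (j < i)%N & m = g + v *+ j.
  move=> mz1 mp; have [j mE] := string m mz1; exists j => //.
  have := pmax m; rewrite mem_finsupp => /(_ mz1 mp).
  rewrite /weight_pos /= raddfB /= pE mE !raddfD !raddfMn /= wv.
  have ij : i <> j by move=> ij; move: mp; rewrite pE mE ij eqxx.
  rewrite !pmulrn addrACA subrr add0r mulNrz !mulrzz -mulrBr.
  rewrite pmulr_rgt0 // mulf_eq0 gt_eqF //= subr_gt0 ltz_nat => /orP[//|].
  by rewrite subr_eq0 => /andP[/eqP[] /ij].
have Tp j : tauF (tauT (g + v *+ j)) = g + v *+ j + v *~ g (inl k).
  by rewrite tauFT_col ffunE ffunMnE col_same mul0rn addr0.
have memk m j : m = g + v *+ j -> m (inl k) = `|g (inl k)|%N.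
  by move=> ->; rewrite ffunE ffunMnE col_same mul0rn addr0 gez0_abs.
have Xs' m : cf s z1 m != 0 -> LP s' (monomial s m).
  by move=> /string[j /memk mk]; have [] := monomial_expand mk.
(* The terms with j < i expand to at most j + g_k steps along [v], short of the i + g_k steps of
   [tauT p], so nothing cancels there. *)
have z1p : cf s' z1 (tauT p) != 0.
  have zE := cfP z1s; rewrite /lincomb (bigD1_seq p) ?mem_finsupp ?fset_uniq //= in zE.
  rewrite -big_filter in zE.
  have [Xp _ Xptop] := monomial_expand (memk p i pE).
  have [rests restQ] : supported s' (fun q => tauF q != tauF (tauT p))
      (\sum_(m <- [seq m <- finsupp (cf s z1) | m != p]) cf s z1 m *: monomial s m).
    apply: supported_sum => // m; rewrite mem_filter mem_finsupp => /andP[mp mz].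
    apply: supportedZ => //; have [j ji mE] := top m mz mp.
    have [Xm Xmsupp _] := monomial_expand (memk m j mE); split => // q /Xmsupp[l la ->].
    apply/eqP; rewrite pE Tp mE -!addrA => /addrI; rewrite !pmulrn -!mulrzDr.
    by move=> /col_mul_inj; lia.
  rewrite zE cfD //; last exact: LPZ.
  have -> : cf s' (\sum_(m <- [seq m <- finsupp (cf s z1) | m != p])
                     cf s z1 m *: monomial s m) (tauT p) = 0.
    by apply/eqP/negPn/negP => /restQ; rewrite eqxx.
  by rewrite addr0 cfZ //; exact: base_mul_neq0.
(* In the mutated seed the column [k] becomes [-v]: going down from the degree, which corresponds to
   g + g_k v, cannot reach g + (i + g_k) v unless i = 0. *)
have i0 : i = 0%N.
  have [/zdom'[n nE] Qp] := z1Q' _ z1p; rewrite pE Tp in Qp.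
  have := congr1 tauF nE; rewrite pE Tp trop_ge0 // raddfD /= tauFT_col.
  rewrite layer_Bvec_mutate.
    rewrite -addrA [v *+ i + _]addrC addrA => /addrI; rewrite !pmulrn -mulrNz.
    by move=> /col_mul_inj; lia.
  have : f (tauF (trop s k g + Bvec s' n)) <= f g by rewrite -nE pE Tp.
  by rewrite raddfD /= trop_ge0 // tauFT_col !raddfD /= raddfMz /= fv mul0rz addr0 gerDl.
have pg : p = g by rewrite pE i0 mulr0n addr0.
apply: (cf_inj free) => //; first exact: LP_monomial.
move=> m; rewrite cf_monomial //; have [<-|gm] := eqVneq g m; first by rewrite z1g.
apply/eqP/negPn/negP => mz; have [|j] := top m mz; first by rewrite pg eq_sym.
by rewrite i0.
Qed.

End Layers.
End OneSide.
End Adjacent.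

(** * Simultaneous approximation at two adjacent seeds *)

Section Link.
Variables (c : flavour) (U Fz : finType) (F : unitAlgType (base c)).
Variable d : U + Fz -> nat.
Hypothesis d_gt0 : forall i, (0 < d i)%N.
Hypothesis F_division : division_ring F.
Notation M := (lattice U Fz).
Notation Seed := (seed U Fz F).
Implicit Types (g m : M) (z : F).

Lemma negative_weight (s : Seed) : dualizable s ->
  exists u : U + Fz -> int, forall k, lin u (col s k) < 0.
Proof.
move=> /(_ (fun=> -1))[L [u [L0 uE]]]; exists u => k.
by rewrite uE mulrN1 oppr_lt0.
Qed.

Lemma pointed_torus (s : Seed) z g : torus d s -> dualizable s -> pointed s z g ->
  [/\ LP s z, cf s z g = 1 & forall h, cf s z h != 0 -> dom_le s h g].
Proof.
move=> st /negative_weight[u uE]; apply: (pointed_support uE).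
exact: torus_free st.
Qed.

Variables (s : Seed) (k : U).
Notation s' := (mutate s k).
Notation tauF := (tau s k false).
Hypotheses (st : torus d s) (s't : torus d s').
Hypotheses (s_dual : dualizable s) (s'_dual : dualizable s').
Let si := torus_int st.
Let sk := torus_uskew st.
Let free := torus_free st.
Let free' := torus_free s't.
Let kk : bz s (inl k) (inl k) = 0 := uskew_diag d_gt0 k sk.
Variables (f : {additive M -> int}).
Hypotheses (fv : f (col s k) = 0) (f_gt0 : forall l, l != k -> 0 < f (col s l)).

Lemma pointed_lowest_layer_ge0 g z : pointed s z g -> pointed s' z (trop s k g) ->
  0 <= g (inl k) ->
  supported s (fun m => f g < f m) (z - monomial s g) /\
  supported s' (fun m => f g < f (tauF m)) (z - monomial s g).
Proof.
move=> /(pointed_torus st s_dual)[zs zg zdom].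
move=> /(pointed_torus s't s'_dual)[zs' zg' zdom'] gk.
exact: (pointed_lowest_layer d_gt0 F_division st s't s_dual fv f_gt0).
Qed.

(** This is the nonnegative case for the mutation read backwards, with the weight [f \o tauF]; the
    lowest layer is then a monomial of [s']. *)
Lemma pointed_lowest_layer_le0 g z : pointed s z g -> pointed s' z (trop s k g) ->
  g (inl k) <= 0 ->
  supported s (fun m => f g < f m) (z - monomial s' (trop s k g)) /\
  supported s' (fun m => f g < f (tauF m)) (z - monomial s' (trop s k g)).
Proof.
move=> /(pointed_torus st s_dual)[zs zg zdom].
move=> /(pointed_torus s't s'_dual)[zs' zg' zdom'] gk.
have s''E : mutate s' k = s by exact: (mutateK d_gt0 F_division k st s_dual).
have tauT m : tau s' k false m = tau s k true m by apply: tau_mutate.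
have tauF' m : tau s' k true m = tauF m by apply: tau_mutate.
pose f' : {additive M -> int} := f \o tauF.
have g'E : trop s k g = tauF g by apply: (trop_le0 d_gt0 st).
have f'g : f' (trop s k g) = f g by rewrite g'E /= (tauK d_gt0).
have f'v : f' (col s' k) = 0.
  by rewrite /= col_mutate_same // raddfN /= (tau_col d_gt0) // raddfN fv oppr0.
have f'_gt0 l : l != k -> 0 < f' (col s' l).
  by move=> lk; rewrite /= (col_mutate d_gt0) // raddfD raddfMz /= fv mul0rz addr0 f_gt0.
have s''t : torus d (mutate s' k) by rewrite s''E.
have g'k : 0 <= trop s k g (inl k) by rewrite g'E tauE // eqxx oppr_ge0.
have g''E : trop s' k (trop s k g) = g.
  by rewrite (trop_ge0 d_gt0 s't g'k) tauF' g'E (tauK d_gt0).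
have := pointed_lowest_layer d_gt0 F_division s't s''t s'_dual f'v f'_gt0
  (g := trop s k g) zs'.
rewrite s''E g''E => /(_ zs g'k zg' zdom' zdom); rewrite f'g => -[h' h]; split.
  apply: supported_sub h => m /=; rewrite tauT (tauFT d_gt0) //.
  by rewrite raddfD raddfMz /= fv mul0rz addr0.
exact: supported_sub h'.
Qed.

Variables (w : M -> F) (G : M -> M).
Hypotheses (G_surj : forall m, exists g, G g = m).
Hypotheses (w_pointed : forall g, pointed s (w g) (G g))
           (w_pointed' : forall g, pointed s' (w g) (trop s k (G g))).

Lemma trop_surj m' : exists g, trop s k (G g) = m'.
Proof.
have s''E : mutate s' k = s by exact: (mutateK d_gt0 F_division k st s_dual).
have tauT m : tau s' k false m = tau s k true m by apply: tau_mutate.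
have tauF' m : tau s' k true m = tauF m by apply: tau_mutate.
have [h|h] := leP 0 (m' (inl k)).
  have [g gE] := G_surj (tauF m'); exists g; rewrite gE (trop_le0 d_gt0 st).
    by rewrite (tauK d_gt0).
  by rewrite tauE // eqxx oppr_le0.
have [g gE] := G_surj (tau s k true m'); exists g; rewrite gE (trop_ge0 d_gt0 st).
  by rewrite (tauK d_gt0).
by rewrite tauE // eqxx oppr_ge0 ltW.
Qed.

(** Here [f] is nonnegative on the columns, so it cannot decrease when going down in the dominance
    order; depth at both seeds is measured on the scale of [s]. *)
Definition deep (N : int) z := supported s (fun m => N <= f m) z /\
                       supported s' (fun m => N <= f (tauF m)) z.

(** Layer [N] is cut by the sign of the exponent at [k]. The part [z1] with nonnegative exponent is
    expanded in monomials of [s], the part [z3] with negative exponent in monomials of [s']; each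
    monomial is then replaced by the pointed element having it as lowest layer. *)
Lemma deep_step (N : int) z : deep N z -> exists b, deep (N + 1) (z - lincomb w b).
Proof.
move=> [[zs zN] [zs' zN']].
pose Q m := 0 <= m (inl k) /\ f m <= N; pose Q2 m := f m <= N.
have invQ2 : col_invariant s k Q2 by move=> m; rewrite /Q2 raddfD /= fv addr0.
have invQ : col_invariant s k Q.
  by move=> m; rewrite /Q raddfD /= fv addr0 !ffunE kk addr0.
have [z1 [z2 [e z1s _ z2s z2s']]] :=
  homogeneous_split d_gt0 F_division st s't s_dual invQ zs zs'.
have [z3 [z4 [e2 _ z3s' z4s z4s']]] :=
  homogeneous_split d_gt0 F_division st s't s_dual invQ2 z2s.1 z2s'.1.
have sumP (r : seq M) (x : M -> base c) (e1 : M -> M) (X : M -> F) :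
    (forall m, m \in r -> deep (N + 1) (w (e1 m) - X m)) ->
    exists b, deep (N + 1) (\sum_(m <- r) x m *: X m - lincomb w b).
  move=> h; have [b [bE _]] := fsfun_sum F r e1 x; exists b.
  have E m : x m *: X m - x m *: w (e1 m) = (- x m) *: (w (e1 m) - X m).
    by rewrite scaleNr -scalerN opprB scalerBr.
  rewrite bE -sumrB; under eq_bigr do rewrite E.
  by split; apply: supported_sum => // m /h[hm hm']; exact: supportedZ.
have [e1 e1E] := choice G_surj; have [e3 e3E] := choice trop_surj.
have [b1 b1P] : exists b, deep (N + 1) (z1 - lincomb w b).
  rewrite (cfP z1s.1); apply: (sumP _ _ e1) => m.
  rewrite mem_finsupp => /z1s.2[zm [mk mN]].
  have fm : f m = N by apply/eqP; rewrite eq_le mN; exact: zN.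
  have := pointed_lowest_layer_ge0 (w_pointed (e1 m)) (w_pointed' (e1 m)).
  rewrite e1E => /(_ mk)[]; rewrite fm => h h'.
  by split; [apply: supported_sub h | apply: supported_sub h'] => q; rewrite lezD1.
have [b3 b3P] : exists b, deep (N + 1) (z3 - lincomb w b).
  rewrite (cfP z3s'.1); apply: (sumP _ _ e3) => m.
  rewrite mem_finsupp => /z3s'.2[/z2s'.2[/zN' Nm nQ] mN].
  have fm : f (tauF m) = N by apply/eqP; rewrite eq_le; apply/andP; split.
  have mk : (tauF m) (inl k) < 0 by rewrite ltNge; apply/negP => h; apply: nQ; split.
  have Ge : G (e3 m) (inl k) < 0.
    have /(congr1 (fun h : M => h (inl k))) := e3E m.
    by rewrite ffunE eqxx; move: mk; rewrite tauE // eqxx => mk' me; rewrite -me opprK in mk'.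
  have gE : tauF m = G (e3 m).
    by rewrite -[in LHS](e3E m) (trop_le0 d_gt0 st (ltW Ge)) (tauK d_gt0).
  have := pointed_lowest_layer_le0 (w_pointed (e3 m)) (w_pointed' (e3 m)) (ltW Ge).
  rewrite e3E -gE fm => -[h h'].
  by split; [apply: supported_sub h | apply: supported_sub h'] => q; rewrite lezD1.
have z4P : deep (N + 1) z4.
  split.
    by apply: supported_sub z4s => q [_ /negP]; rewrite -ltNge lezD1.
  by apply: supported_sub z4s' => q [_ /negP]; rewrite -ltNge lezD1.
have [b [bE _]] := fsfun_lin F 1 b1 b3; exists b.
have -> : z - lincomb w b = (z1 - lincomb w b1) + (z3 - lincomb w b3) + z4.
  by rewrite bE scale1r e e2 [in RHS]addrACA -opprD [RHS]addrAC !addrA.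
by case: b1P b3P z4P => ? ? [? ?] [? ?]; split; do 2!apply: supportedD => //.
Qed.

Lemma deep_exists z : LP s z -> LP s' z -> exists N : int, deep N z.
Proof.
have below (A : {fset M}) (h : M -> int) : exists N, forall m, m \in A -> N <= h m.
  exists (- (\sum_(m <- A) `|h m|)%N%:Z) => m mA.
  have : (`|h m| <= \sum_(m <- A) `|h m|)%N.
    by rewrite (bigD1_seq m) ?fset_uniq //= leq_addr.
  lia.
move=> zs zs'; have [N1 N1P] := below (finsupp (cf s z)) f.
have [N2 N2P] := below (finsupp (cf s' z)) (f \o tauF).
exists (Num.min N1 N2); split; split=> // m; rewrite -mem_finsupp => mz.
  by rewrite ge_min N1P.
by rewrite ge_min (N2P m mz) orbT.
Qed.

Lemma deep_approx z (N : int) : LP s z -> LP s' z -> exists b, deep N (z - lincomb w b).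
Proof.
move=> zs zs'; have [N0 z0] := deep_exists zs zs'.
have [n Nn] : exists n : nat, N <= N0 + n%:Z by exists `|N - N0|%N; lia.
have deepE x (a b : int) : a = b -> deep a x -> deep b x by move=> ->.
have : exists b, deep (N0 + n%:Z) (z - lincomb w b).
  elim: n {Nn} => [|n [b bP]].
    have [b [bE _]] := @fsfun_sum c U Fz F M [::] id (fun=> 0).
    by exists b; rewrite bE big_nil !subr0.
  have [b' b'P] := deep_step bP; have [b2 [b2E _]] := fsfun_lin F 1 b b'.
  by exists b2; rewrite b2E scale1r opprD addrA; apply: deepE _ b'P; lia.
move=> [b [bs bs']]; exists b.
by split; [apply: supported_sub bs | apply: supported_sub bs'] => m; exact: le_trans Nn.
Qed.

End Link.

(** * Coordinates with respect to compatibly pointed elements *)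

Section PointedFamily.
Variables (c : flavour) (U Fz : finType) (F : unitAlgType (base c)).
Variable d : U + Fz -> nat.
Hypothesis d_gt0 : forall i, (0 < d i)%N.
Hypothesis F_division : division_ring F.
Notation M := (lattice U Fz).
Notation Seed := (seed U Fz F).
Notation fsM := {fsfun M -> base c with 0}.
Implicit Types (s : Seed) (g h m : M) (z : F) (b : fsM) (k : U).

Variables (w : M -> F) (G : Seed -> M -> M).

Definition node s := [/\ torus d s, dualizable s,
  forall g, pointed s (w g) (G s g), injective (G s) & forall m, exists g, G s g = m].

Section Node.
Variable s : Seed.
Hypothesis sn : node s.

Lemma node_expansion g : [/\ LP s (w g), cf s (w g) (G s g) = 1 &
  forall h, cf s (w g) h != 0 -> dom_le s h (G s g)].
Proof. by case: sn => st sd sp _ _; exact: (pointed_torus st sd (sp g)). Qed.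

Lemma node_LP_lincomb b : LP s (lincomb w b).
Proof.
have [/torus_free free _ _ _ _] := sn.
by apply: LP_sum => // g; apply: LPZ => //; case: (node_expansion g).
Qed.

Lemma cf_node_lincomb b m :
  cf s (lincomb w b) m = \sum_(g <- finsupp b) b g * cf s (w g) m.
Proof.
have [st _ _ _ _] := sn; have free := torus_free st.
rewrite /lincomb cf_bigsum // => [|g]; last first.
  by apply: LPZ => //; case: (node_expansion g).
by apply: eq_bigr => g _; rewrite cfZ //; case: (node_expansion g).
Qed.

(** Take [h] of maximal degree above that of [g] among the terms of [b]: no other term reaches the
    exponent [G s h]. *)
Lemma node_triangular b g : b g != 0 -> exists h,
  [/\ b h != 0, dom_le s (G s g) (G s h) & cf s (lincomb w b) (G s h) = b h].
Proof.
move=> bg; have [st sd _ G_inj _] := sn.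
have [u uE] := negative_weight sd.
have gA : G s g \in [fset G s h | h in finsupp b].
  by apply/imfsetP; exists g; rewrite //= mem_finsupp.
have [_ [/imfsetP[h /= hb ->] _ gh hmax]] := dom_maximal_above uE (p := predT) gA isT.
exists h; split => //; first by rewrite -mem_finsupp.
have [ws wh _] := node_expansion h.
rewrite cf_node_lincomb (bigD1_seq h) ?fset_uniq //= wh mulr1.
rewrite big1_seq ?addr0 // => i /andP[ih ib].
have [->|wih] := eqVneq (cf s (w i) (G s h)) 0; first by rewrite mulr0.
have [_ _ /(_ _ wih) hi] := node_expansion i.
have iA : G s i \in [fset G s h | h in finsupp b] by apply/imfsetP; exists i.
have /G_inj e := hmax _ iA isT hi.
by rewrite e eqxx in ih.
Qed.

(* [b] computes the coordinate of [z] on [w g] in the completion of [LP s]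
   where elements small for the dominance order are neglected. *)
Definition approx z g b :=
  forall h, dom_le s (G s g) h -> cf s (z - lincomb w b) h = 0.

(** The difference of the two combinations vanishes at all exponents above [G s g], whereas
    [node_triangular] would produce a nonzero coefficient there. *)
Lemma approx_unique z g b b' : LP s z -> approx z g b -> approx z g b' -> b g = b' g.
Proof.
move=> zs bP b'P; have [st _ _ _ _] := sn; have free := torus_free st.
have [e [eE eV]] := fsfun_lin F (-1) b b'.
apply/eqP; rewrite -subr_eq0 -mulN1r -eV; apply/negPn/negP => /node_triangular.
move=> [h [eh gh]]; suff -> : cf s (lincomb w e) (G s h) = 0 by move/eqP; rewrite eq_sym (negPf eh).
have -> : lincomb w e = (z - lincomb w b') - (z - lincomb w b).
  by rewrite eE scaleN1r opprB [RHS]addrC addrA subrK.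
have LPz x : LP s (z - lincomb w x) by apply: LPB => //; exact: node_LP_lincomb.
by rewrite cfB // bP // b'P // subrr.
Qed.

Lemma approx_support z g b : LP s z -> approx z g b -> b g != 0 ->
  exists2 h, cf s z h != 0 & dom_le s (G s g) h.
Proof.
move=> zs bP /node_triangular[h [bh gh e]]; exists (G s h) => //.
have [st _ _ _ _] := sn; have free := torus_free st.
have := bP _ gh; rewrite cfB //; last exact: node_LP_lincomb.
by rewrite e => /eqP; rewrite subr_eq0 => /eqP->.
Qed.

(** At a maximal exponent the single leading term is already a sufficient approximation. *)
Lemma approx_maximal z g : LP s z -> cf s z (G s g) != 0 ->
  (forall h, cf s z h != 0 -> dom_le s (G s g) h -> h = G s g) ->
  exists2 b, approx z g b & b g != 0.
Proof.
move=> zs zg gmax; have [st sd _ _ _] := sn; have free := torus_free st.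
have [u uE] := negative_weight sd.
have [b [bE bV]] := @fsfun_sum c U Fz F M [:: g] id (fun=> cf s z (G s g)).
exists b; last by rewrite bV big_seq1 eqxx mul1r.
have [wsg wg wdom] := node_expansion g.
move=> h gh; rewrite bE big_seq1 cfB ?cfZ //; last exact: LPZ.
have [->|hg] := eqVneq h (G s g); first by rewrite wg mulr1 subrr.
have -> : cf s z h = 0.
  by apply/eqP/negPn/negP => zh; move: hg; rewrite (gmax h zh gh) eqxx.
have -> : cf s (w g) h = 0; last by rewrite mulr0 subrr.
apply/eqP/negPn/negP => /wdom hG; move: hg.
by rewrite (dom_le_anti uE hG gh) eqxx.
Qed.

End Node.

Lemma approx_link s k z g : node s -> node (mutate s k) ->
  (forall g, G (mutate s k) g = trop s k (G s g)) ->
  LP s z -> LP (mutate s k) z ->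
  exists b, approx s z g b /\ approx (mutate s k) z g b.
Proof.
move=> sn s'n Gtrop zs zs'.
have [st sd sp _ surj] := sn; have [s't s'd s'p _ _] := s'n.
have free := torus_free st; have free' := torus_free s't.
have [L [u [L0 uE]]] := sd (fun l => (l != k)%:R).
have uk : lin u (col s k) = 0 by rewrite uE eqxx mulr0.
have u_gt0 l : l != k -> 0 < lin u (col s l) by move=> lk; rewrite uE lk mulr1.
have u_ge0 l : 0 <= lin u (col s l).
  by have [->|/u_gt0/ltW//] := eqVneq l k; rewrite uk.
have u'_ge0 l : 0 <= lin u (tau s k false (col (mutate s k) l)).
  have [si sk] := (torus_int st, torus_uskew st).
  have [->|lk] := eqVneq l k.
    by rewrite col_mutate_same // raddfN /= (tau_col d_gt0) // raddfN /= uk oppr0.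
  by rewrite (col_mutate d_gt0) // raddfD raddfMz /= uk mul0rz addr0.
have sp' g' : pointed (mutate s k) (w g') (trop s k (G s g')) by rewrite -Gtrop.
(* The weight is nonnegative on the columns of both seeds, so every exponent above the degree of
   [w g] at either seed has weight below [N]. *)
pose N := Num.max (lin u (G s g)) (lin u (tau s k false (G (mutate s k) g))) + 1.
have [b [[_ bs] [_ bs']]] :=
  deep_approx d_gt0 F_division st s't sd s'd uk u_gt0 surj sp sp' N zs zs'.
exists b; split=> h [n nE]; apply/eqP/negPn/negP.
  move=> /bs; apply/negP; rewrite -ltNge /N ltzD1 le_max.
  apply/orP; left; rewrite nE raddfD /= lerDl lin_Bvec.
  by apply: sumr_ge0 => l _; apply: mulrn_wge0; exact: u_ge0.
move=> /bs'; apply/negP; rewrite -ltNge /N ltzD1 le_max.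
apply/orP; right; rewrite nE !raddfD /= lerDl lin_Bvec raddf_sum.
by apply: sumr_ge0 => l _; rewrite !raddfMn; apply: mulrn_wge0; exact: u'_ge0.
Qed.

Fixpoint nodes s (ks : seq U) : Prop :=
  node s /\ if ks is k :: ks' then
    (forall g, G (mutate s k) g = trop s k (G s g)) /\ nodes (mutate s k) ks'
  else True.

Lemma nodes_head s ks : nodes s ks -> node s.
Proof. by case: ks => [|k ks] []. Qed.

Lemma mutates_rev s ks : nodes s ks -> mutates (mutates s ks) (rev ks) = s.
Proof.
elim: ks s => //= k ks IH s [[st sd _ _ _] [_ nd]].
rewrite rev_cons /mutates foldl_rcons -/(mutates _ _) -/(mutates _ (rev ks)) IH //.
exact: (mutateK d_gt0 F_division k st sd).
Qed.

Lemma nodes_LP s ks z : nodes s ks -> upper_cluster_algebra (mutates s ks) z -> LP s z.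
Proof. by move=> nd /(_ (rev ks) I); rewrite /= mutates_rev. Qed.

(** At each intermediate seed, uniqueness identifies the coordinates computed by the links on its
    two sides. *)
Lemma approx_chain s ks z g b : nodes s ks ->
  upper_cluster_algebra (mutates s ks) z ->
  approx (mutates s ks) z g b -> b g != 0 ->
  exists2 b', approx s z g b' & b' g != 0.
Proof.
elim: ks s => [|k ks IH] s nd zU bP bg; first by exists b.
have zs : LP s z := nodes_LP nd zU.
have [sn [Gtrop nd']] := nd.
have [b' b'P b'g] := IH _ nd' zU bP bg.
have s'n := nodes_head nd'.
have zs' : LP (mutate s k) z := nodes_LP nd' zU.
have [b2 [b2s b2s']] := approx_link g sn s'n Gtrop zs zs'.
by exists b2 => //; rewrite (approx_unique s'n zs' b2s' b'P).
Qed.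

(** Bijectivity of the degree map is known at the last seed and propagates backwards: injectivity
    because the next degrees are functions of the current ones, surjectivity because [trop] is
    injective. *)
Lemma nodes_build s ks :
  (forall j, torus d (mutates s (take j ks)) /\ dualizable (mutates s (take j ks))) ->
  (forall j g, pointed (mutates s (take j ks)) (w g) (G (mutates s (take j ks)) g)) ->
  (forall j k ks', drop j ks = k :: ks' -> forall g,
     G (mutate (mutates s (take j ks)) k) g
     = trop (mutates s (take j ks)) k (G (mutates s (take j ks)) g)) ->
  injective (G (mutates s ks)) -> (forall m, exists g, G (mutates s ks) g = m) ->
  nodes s ks.
Proof.
elim: ks s => [|k ks IH] s tP pP GP inj surj.
  by have [? ?] := tP 0%N; split=> //; split=> //; exact: pP 0%N.
have nd' : nodes (mutate s k) ks.
  apply: IH => // j; [exact: tP j.+1 | exact: pP j.+1 |].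
  by move=> k' ks' e; exact: (GP j.+1 k' ks').
have Gtrop := GP 0%N k ks (drop0 _); rewrite take0 /= in Gtrop.
have [_ _ _ inj' surj'] := nodes_head nd'.
have [st sd] := tP 0%N; rewrite take0 /= in st sd.
have [[s't s'd] sp] := (tP 1%N, pP 0%N); rewrite take0 /= in sp.
rewrite /= take0 /= in s't s'd.
split=> //; split=> //; first by move=> g h e; apply: inj'; rewrite !Gtrop e.
move=> m; have [g gE] := surj' (trop s k m); exists g.
by apply: (trop_inj d_gt0 (k := k) st); rewrite -Gtrop.
Qed.

End PointedFamily.

(** * Finiteness and the basis theorem *)

Section Finiteness.
Variables (c : flavour) (U Fz : finType) (F : unitAlgType (base c)).
Variable d : U + Fz -> nat.
Hypothesis d_gt0 : forall i, (0 < d i)%N.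
Hypothesis F_division : division_ring F.
Notation M := (lattice U Fz).
Notation Seed := (seed U Fz F).
Implicit Types (s : Seed) (g h m : M) (z : F) (k : U).

Lemma upper_cluster_algebra_lin (t : Seed) (x : base c) z z' :
  upper_cluster_algebra t z -> upper_cluster_algebra t z' ->
  upper_cluster_algebra t (z + x *: z').
Proof. by move=> zU z'U ks _; apply: LP_lin; [exact: zU | exact: z'U]. Qed.

Lemma integral_uskew_mutates s ks : integral s -> uskew d s ->
  integral (mutates s ks) /\ uskew d (mutates s ks).
Proof.
elim: ks s => [|k ks IH] s si sk //=; apply: IH.
  exact: integral_mutate.
exact: uskew_mutate.
Qed.

Variables t tm1 : Seed.
Hypothesis tm1_torus : torus d tm1.
Hypothesis tm1_frac :
  forall z, exists a b, [/\ LP tm1 a, LP tm1 b, b != 0 & z = a / b].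
Variable mu : seq U.
Hypothesis t_eq : t = mutates tm1 mu.
Hypothesis t_dual : dualizable t.

Lemma dualizable_along j : dualizable (mutates tm1 (take j mu)).
Proof.
have [si sk] := integral_uskew_mutates (take j mu) (torus_int tm1_torus) (torus_uskew tm1_torus).
apply: (dualizable_mutates d_gt0 (mu := drop j mu)) => //.
by rewrite /mutates -foldl_cat cat_take_drop -/(mutates _ _) -t_eq.
Qed.

Lemma tm1_dual : dualizable tm1.
Proof. by have := dualizable_along 0; rewrite take0. Qed.

Variable u : U + Fz -> int.
Hypothesis u_lt0 : forall k, lin u (col tm1 k) < 0.
Notation P := (weight_pos (lin u)).

Lemma tracked_along j : torus d (mutates tm1 (take j mu)) /\
  exists psi C, tracked d tm1 P (mutates tm1 (take j mu)) psi C.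
Proof.
apply: (tracked_mutates d_gt0 F_division tm1_torus tm1_dual tm1_frac
  (weight_pos0 _) (@weight_posD _ _ _) (@weight_pos_total _ _ _)) => //.
  exact: tracked0.
exact: dualizable_along.
Qed.

Lemma pointed_lead a z g : z = lincomb (monomial tm1) a -> a g != 0 ->
  (forall h, a h != 0 -> dom_le tm1 h g) -> is_lead tm1 P z g.
Proof.
move=> zE ag amax; have free := torus_free tm1_torus.
rewrite /is_lead zE cf_lincomb //; split => //; first exact: LP_lincomb.
move=> q /amax qg /eqP neq; apply: weight_pos_gt0; rewrite raddfB subr_gt0.
exact: (dom_lt_weight u_lt0).
Qed.

Lemma degree_val z g : has_degree tm1 z g -> is_val tm1 P z g.
Proof.
move=> [a za]; case: (za) => zE [ga _] _.
apply: (lead_val (torus_free tm1_torus)).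
apply: pointed_lead zE _ _; first by rewrite -mem_finsupp.
exact: (degree_support u_lt0 za).
Qed.

Hypothesis tm1_shift : is_shift tm1 t.

(** The shift condition makes the unfrozen part of [psi] minus a permutation matrix, and the duality
    then makes [C], up to positive factors, minus a permutation matrix too. *)
Lemma shift_col psi C : tracked d tm1 P t psi C -> forall k,
  0 < lin u (lin psi (col t k)).
Proof.
move=> str k; have [_ [sigma sigmaP]] := tm1_shift.
have mul := torus_mul tm1_torus; have free := torus_free tm1_torus.
have psiE i l : psi (inl i) (inl l) = - (sigma i == l)%:R.
  have [g [/degree_val gv /(_ l)]] := sigmaP i.
  have -> : psi (inl i) = g.
    apply: (val_inj F_division mul free tm1_frac (weight_pos0 _)
      (@weight_posD _ _ _) (@weight_pos_total _ _ _)) gv.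
    exact: tracked_val str _.
  by rewrite !ffunE (inj_eq inl_inj) => /eqP; rewrite addr_eq0 => /eqP.
have CE l : C k l * codeg d l = - (sigma k == l)%:R * codeg d k.
  (* For this basis vector only the summand of index [l] survives, which isolates [C k l]. *)
  have := tracked_dual str (fvec (inl ((sigma^-1)%g l))) k.
  rewrite (bigD1 l) //= lin_fvec psiE permKV eqxx big1 ?addr0; last first.
    by move=> i il; rewrite psiE permKV eq_sym (negPf il) oppr0 !mul0r.
  rewrite ffunE (inj_eq inl_inj) mulN1r !mulNr => /eqP; rewrite eqr_oppLR => /eqP->.
  by congr (- (_%:R * _)); congr nat_of_bool; apply/eqP/eqP => [<-|<-]; rewrite ?permKV ?permK.
rewrite (tracked_col str) raddf_sum (bigD1 (sigma k)) //= big1 ?addr0 => [|l lk].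
  rewrite raddfMz /= mulrzz; have := CE (sigma k); rewrite eqxx mulN1r => e.
  have : C k (sigma k) * codeg d (sigma k) < 0 by rewrite e oppr_lt0 codeg_gt0.
  by rewrite pmulr_llt0 ?codeg_gt0 // => h; rewrite nmulr_rgt0.
have := CE l; rewrite eq_sym (negPf lk) oppr0 mul0r => /eqP.
rewrite mulf_eq0 [codeg _ _ == _]gt_eqF ?codeg_gt0 // orbF => /eqP->.
by rewrite mulr0z raddf0.
Qed.

(** The valuation of [z] is [g'] when read at [tm1], and [lin psi m] for some [m] in the support
    when read at [t]. Since [m] lies below [g] and the columns have positive image weight, [m]
    weighs at least as much as [g]. *)
Lemma leading_exponent z g g' : pointed t z g -> pointed tm1 z g' ->
  torus d t -> forall psi C, tracked d tm1 P t psi C ->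
  lin u (lin psi g) <= lin u g'.
Proof.
move=> zg zg' tt psi C str.
have mul := torus_mul tm1_torus; have free := torus_free tm1_torus.
have [zt ztg zdom] := pointed_torus tt t_dual zg.
have g'v : is_val tm1 P z g'.
  by apply: degree_val; case: zg' => a za _; exists a.
have vmon m : is_val tm1 P (monomial t m) (lin psi m).
  exact: (val_seed_monomial F_division mul free tm1_frac (weight_pos0 _)
    (@weight_posD _ _ _) (@weight_pos_total _ _ _) m (tracked_val str)).
have zg0 : exists m, cf t z m != 0 by exists g; rewrite ztg oner_neq0.
have [m /zdom[n gE]] := val_lincomb F_division mul free tm1_frac (weight_pos0 _)
  (@weight_posD _ _ _) (@weight_pos_total _ _ _) (tracked_inj d_gt0 str) vmon zg0.
rewrite -cfP // => /(val_inj F_division mul free tm1_frac (weight_pos0 _)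
  (@weight_posD _ _ _) (@weight_pos_total _ _ _) g'v) ->.
rewrite gE !raddfD /= lerDl lin_Bvec raddf_sum; apply: sumr_ge0 => k _.
by rewrite raddfMn /= mulrn_wge0 // ltW // (shift_col str).
Qed.

Variables (w : M -> F) (G : Seed -> M -> M).
Hypothesis nd : nodes d w G tm1 mu.
Hypothesis Gt : G t = id.

Lemma t_node : node d w G t.
Proof.
suff : forall s ks, nodes d w G s ks -> node d w G (mutates s ks).
  by move=> /(_ _ _ nd); rewrite -t_eq.
move=> s ks; elim: ks s => [|k ks IH] s [sn //= [_ h]]; exact: IH.
Qed.

Lemma node_independent : lin_indep w.
Proof.
move=> a a0 g; apply/eqP/negPn/negP => /(node_triangular t_node)[h [ah _]].
have [tt _ _ _ _] := t_node.
by rewrite a0 (cf0 (torus_free tt)) => e; rewrite -e eqxx in ah.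
Qed.

Lemma node_finite (A A' : {fset M}) : exists T : {fset M}, forall g,
  (exists2 h, h \in A & dom_le t g h) ->
  (exists2 h', h' \in A' & dom_le tm1 (G tm1 g) h') -> g \in T.
Proof.
have [tt td tp _ _] := t_node; have [_ _ tm1p _ _] := nodes_head nd.
have [tt' [psi [C str]]] := tracked_along (size mu).
rewrite take_size -t_eq in tt' str.
pose u' i := - lin u (psi i).
have u'E m : lin u' m = - lin u (lin psi m).
  transitivity (- lin (fun i => lin u (psi i)) m); last first.
    by congr (- _); rewrite [RHS]lin_comp.
  by rewrite {1 2}/lin -sumrN; apply: eq_bigr => i _; rewrite mulNrz.
have u'_lt0 k : lin u' (col t k) < 0 by rewrite u'E oppr_lt0; exact: shift_col str k.
(* For g = h + Bvec t n, [dom_weight] bounds n_k by the weight [u'] of h minus that of g, and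
   [leading_exponent] bounds the latter loss by the weight [u] of h'. Summing over all pairs makes
   the bound uniform. *)
pose B := (\sum_(h <- A) \sum_(h' <- A') absz (lin u' h + lin u h')%R)%N.
pose T := [fset m in [seq h + Bvec t [ffun k => nat_of_ord ((n : {ffun U -> 'I_B.+1}) k)]
                     | h <- (A : seq M), n <- enum {: {ffun U -> 'I_B.+1}}]].
exists T => g [h hA [n hE]] [h' h'A gh'].
have nB k : (n k < B.+1)%N.
  have h1 := dom_weight h n u'_lt0 k; rewrite -hE /= !u'E in h1.
  have h2 : lin u (lin psi g) <= lin u h'.
    apply: le_trans (dom_le_weight u_lt0 gh').
    apply: leading_exponent (tm1p g) tt _ _ str.
    by have := tp g; rewrite Gt.
  have BP : (absz (lin u' h + lin u h')%R <= B)%N.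
    rewrite /B (bigD1_seq h) ?fset_uniq //=; apply: leq_trans (leq_addr _ _).
    by rewrite (bigD1_seq h') ?fset_uniq //= leq_addr.
  have nP : (n k)%:Z <= lin u' h + lin u h'.
    move: h1 h2; rewrite u'E.
    move: (lin u (lin psi g) : int) (lin u (lin psi h) : int) (lin u h' : int).
    by move=> X Y Z; rewrite /=; lia.
  by rewrite ltnS -lez_nat (le_trans nP) // (le_trans (ler_norm _)) // -abszE lez_nat.
rewrite !inE /=; apply/allpairsP.
exists (h, [ffun k => Ordinal (nB k)]); rewrite mem_enum; split=> //=.
by rewrite hE; congr (_ + Bvec t _); apply/ffunP => k; rewrite !ffunE.
Qed.

(** * Termination of the subtraction of leading terms *)

Section Spanning.
Hypothesis wU : forall g, upper_cluster_algebra t (w g).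

Definition below (s : Seed) (A : {fset M}) m := exists2 h, h \in A & dom_le s m h.

Lemma below_sub (s : Seed) (A A' : {fset M}) m :
  (forall h, h \in A -> below s A' h) -> below s A m -> below s A' m.
Proof.
by move=> AA' [h /AA'[h' h'A hh'] mh]; exists h' => //; exact: dom_le_trans hh'.
Qed.

(** The coordinate of [z] on [w g] is nonzero at [t], where [g] is maximal; carried back along the
    sequence, it forces the degree of [w g] at [tm1] below the support of [z] there. *)
Lemma leading_below z g : upper_cluster_algebra t z -> cf t z g != 0 ->
  (forall h, cf t z h != 0 -> dom_le t g h -> h = g) ->
  below tm1 (finsupp (cf tm1 z)) (G tm1 g).
Proof.
move=> zU zg gmax; have zt : LP t z := zU [::] I.
have zU' : upper_cluster_algebra (mutates tm1 mu) z by rewrite -t_eq.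
have [||b bP bg] := @approx_maximal _ _ _ _ _ w G t t_node z g zt; rewrite ?Gt //.
rewrite t_eq in bP; have [b' b'P b'g] := approx_chain d_gt0 F_division nd zU' bP bg.
have [h hz gh] := approx_support (nodes_head nd) (nodes_LP d_gt0 F_division nd zU') b'P b'g.
by exists h; rewrite ?mem_finsupp.
Qed.

Lemma spanning_induction (A A' T : {fset M}) :
  (forall g, below t A g -> below tm1 A' (G tm1 g) -> g \in T) ->
  forall z, upper_cluster_algebra t z ->
  (forall h, cf t z h != 0 -> below t A h) ->
  (forall h, cf tm1 z h != 0 -> below tm1 A' h) ->
  exists a, z = lincomb w a.
Proof.
move=> TP; have [tt _ _ _ _] := t_node; have free := torus_free tt.
have free1 := torus_free tm1_torus.
have LPtm1 y : upper_cluster_algebra t y -> LP tm1 y.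
  by move=> yU; apply: (nodes_LP d_gt0 F_division nd); rewrite -t_eq.
have LPt y : upper_cluster_algebra t y -> LP t y by move=> /(_ [::] I).
have [v v_lt0] := negative_weight t_dual.
(* Its cardinality is the induction measure. Subtracting the term at a maximal [g] keeps both
   supports below the old ones, at [tm1] by [leading_below], and removes [g] itself. *)
pose todo y := [fset g in T | `[< below t (finsupp (cf t y)) g >]].
move=> z; have [N] := ubnP #|` todo z|; elim: N z => // N IH z; rewrite ltnS => cardN.
move=> zU zA zA'; have [->|z0] := eqVneq z 0.
  have [b [bE _]] := @fsfun_sum c U Fz F M [::] id (fun=> 0).
  by exists b; rewrite bE big_nil.
have [m zm] := cf_neq0 free (LPt _ zU) z0; rewrite -mem_finsupp in zm.
have [g [gz _ _ gmax]] := dom_maximal_above v_lt0 (p := predT) zm isT.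
rewrite mem_finsupp in gz.
have {}gmax h : cf t z h != 0 -> dom_le t g h -> h = g.
  by rewrite -mem_finsupp => hz; exact: gmax.
have gtm1 := leading_below zU gz gmax.
have gT : g \in T.
  apply: TP; first exact: zA.
  by apply: below_sub gtm1 => h; rewrite mem_finsupp; exact: zA'.
have [wg1 wgg wdom] := node_expansion t_node g; rewrite Gt in wgg wdom.
have [wg1' _ wdom'] := node_expansion (nodes_head nd) g.
pose y := z + - cf t z g *: w g.
have yU : upper_cluster_algebra t y by exact: upper_cluster_algebra_lin.
have cfy h : cf t y h = cf t z h - cf t z g * cf t (w g) h.
  by rewrite /y cf_lin ?mulNr //; exact: LPt.
have cfy' h : cf tm1 y h = cf tm1 z h - cf t z g * cf tm1 (w g) h.
  by rewrite /y cf_lin ?mulNr //; exact: LPtm1.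
have yz h : cf t y h != 0 -> below t (finsupp (cf t z)) h.
  rewrite cfy; have [->|zh _] := eqVneq (cf t z h) 0; last first.
    by exists h; [rewrite mem_finsupp | exact: dom_le_refl].
  rewrite sub0r oppr_eq0; have [->|/wdom hg _] := eqVneq (cf t (w g) h) 0.
    by rewrite mulr0 eqxx.
  by exists g; rewrite ?mem_finsupp.
have yz' h : cf tm1 y h != 0 -> below tm1 (finsupp (cf tm1 z)) h.
  rewrite cfy'; have [->|zh _] := eqVneq (cf tm1 z h) 0; last first.
    by exists h; [rewrite mem_finsupp | exact: dom_le_refl].
  rewrite sub0r oppr_eq0; have [->|/wdom' hg _] := eqVneq (cf tm1 (w g) h) 0.
    by rewrite mulr0 eqxx.
  by case: gtm1 => h' h'z gh'; exists h' => //; exact: dom_le_trans gh'.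
have [a aE] : exists a, y = lincomb w a.
  apply: IH yU _ _; first last.
  - by move=> h /yz'; apply: below_sub => q; rewrite mem_finsupp; exact: zA'.
  - by move=> h /yz; apply: below_sub => q; rewrite mem_finsupp; exact: zA.
  apply: leq_trans cardN; apply: fproper_ltn_card; rewrite fproperE.
  apply/andP; split.
    apply/fsubsetP => h; rewrite !inE /= => /andP[-> /asboolP hy].
    by apply/asboolP; apply: below_sub hy => q; rewrite mem_finsupp; exact: yz.
  apply/fsubsetPn; exists g; rewrite !inE /= gT /=.
    by apply/asboolP; exists g; [rewrite mem_finsupp | exact: dom_le_refl].
  apply/asboolP => -[h]; rewrite mem_finsupp cfy => yh gh; case/eqP: yh.
  have [e|hg] := eqVneq h g; first by rewrite e wgg mulr1 subrr.
  have -> : cf t z h = 0.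
    by apply/eqP/negPn/negP => /gmax/(_ gh) e; rewrite e eqxx in hg.
  have -> : cf t (w g) h = 0; last by rewrite mulr0 subrr.
  apply/eqP/negPn/negP => /wdom hg'; move: hg.
  by rewrite (dom_le_anti v_lt0 hg' gh) eqxx.
have [b [bE _]] := @fsfun_sum c U Fz F M [:: g] id (fun=> 1).
have [a' [a'E _]] := fsfun_lin F (cf t z g) a b; exists a'.
by rewrite a'E bE big_seq1 scale1r -aE /y scaleNr subrK.
Qed.

Lemma node_spanning z : upper_cluster_algebra t z -> exists a, z = lincomb w a.
Proof.
move=> zU; have [T TP] := node_finite (finsupp (cf t z)) (finsupp (cf tm1 z)).
by apply: (spanning_induction TP zU) => h hz; exists h; rewrite ?mem_finsupp //; exact: dom_le_refl.
Qed.

End Spanning.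
End Finiteness.

Lemma seeds_along_take (c : flavour) (U Fz : finType) (F : unitAlgType (base c))
    (s : seed U Fz F) (ks : seq U) j : seeds_along s ks (mutates s (take j ks)).
Proof.
have [h|/ltnW h] := leqP j (size ks); first by exists j.
by exists (size ks) => //=; rewrite take_size take_oversize.
Qed.

Theorem theorem4p3p1 (c : flavour) (U Fz : finType) (d : U + Fz -> nat)
  (d_gt0 : forall i, (0 < d i)%N)
  (F : unitAlgType (base c)) (F_division : division_ring F)
  (t tm1 : seed U Fz F) (t_seed : is_seed d t) (tm1_seed : is_seed d tm1)
  (t_full_rank : full_rank t) (t_reachable : injective_reachable t)
  (tm1_shift : is_shift tm1 t)
  (mu : seq U) (t_eq : t = mutates tm1 mu)
  (s : lattice U Fz -> F)
  (s_in : forall g, upper_cluster_algebra t (s g))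
  (s_pointed : forall g, pointed t (s g) g)
  (s_compatible : forall g, compatibly_pointed (seeds_along tm1 mu) (s g)) :
  is_basis s (upper_cluster_algebra t).
Proof.
have tm1_torus : torus d tm1 := is_seed_torus tm1_seed.
have t_torus : torus d t := is_seed_torus t_seed.
have t_dual : dualizable t := full_rank_dualizable (torus_int t_torus) t_full_rank.
have frac := seed_frac tm1_seed.
have [u u_lt0] := negative_weight (tm1_dual d_gt0 tm1_torus t_eq t_dual).
have [G GP] := choice s_compatible.
have along j : seeds_along tm1 mu (mutates tm1 (take j mu)) by exact: seeds_along_take.
have t_along : seeds_along tm1 mu t by rewrite t_eq -{2}(take_size mu).
pose G' r g := G g r.
have [v v_lt0] := negative_weight t_dual.
(* Compatibility only provides some degree at [t]; it and [g] dominate each other, being greatest in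
   the same support. *)
have Gt : G' t = id.
  apply: funext => g; have [Gp _] := GP g.
  have [_ Gg Gdom] := pointed_torus t_torus t_dual (Gp t t_along).
  have [_ gg gdom] := pointed_torus t_torus t_dual (s_pointed g).
  apply: (dom_le_anti v_lt0).
    by apply: gdom; rewrite Gg oner_neq0.
  by apply: Gdom; rewrite gg oner_neq0.
have nd : nodes d s G' tm1 mu.
  apply: nodes_build => //.
  - move=> j; split; last exact: (dualizable_along d_gt0 tm1_torus t_eq t_dual).
    by have [] := tracked_along d_gt0 F_division tm1_torus frac t_eq t_dual u j.
  - by move=> j g; have [Gp _] := GP g; exact: Gp.
  - move=> j k ks' e g; have [_ Gc] := GP g.
    have kE : mutate (mutates tm1 (take j mu)) k = mutates tm1 (take j.+1 mu).
      have -> : take j.+1 mu = rcons (take j mu) k.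
        have jmu : (j < size mu)%N by rewrite -subn_gt0 -size_drop e.
        by rewrite (take_nth k jmu) -[j in nth _ _ j]addn0 -nth_drop e.
      by rewrite /mutates foldl_rcons.
    rewrite /G' kE; have := Gc _ _ (along j) (along j.+1) [:: k]; apply.
    by rewrite -kE.
  - by rewrite -t_eq Gt.
  - by move=> m; rewrite -t_eq Gt; exists m.
split=> //.
- exact: (node_independent t_eq nd).
- move=> z zU; exact: (node_spanning d_gt0 F_division tm1_torus frac t_eq t_dual u_lt0 tm1_shift nd Gt s_in zU).
Qed.
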